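(* Let $G$ be a simple algebraic group, $H\subset G$ a connected semisimple subgroup, $\mathfrak g=\mathfrak h\oplus\mathfrak m$ with $\mathfrak m=\mathfrak h^\perp$, and let $\mathcal O$ be a nonzero nilpotent $G$-orbit with $\overline{\mathcal O}\cap\mathfrak m=\{0\}$. Let $\Omega_{\mathcal O}$ be the dense $H$-orbit in $\mathcal O$ and $\boldsymbol\varphi:\overline{\mathcal O}\to\mathfrak h$ the projection along $\mathfrak m$. Then the height of the nilpotent $H$-orbit $\boldsymbol\varphi(\Omega_{\mathcal O})$ equals the height of the nilpotent $G$-orbit it generates: $$\mathrm{ht}_H(\boldsymbol\varphi(\Omega_{\mathcal O}))=\mathrm{ht}_G\bigl(G\cdot\boldsymbol\varphi(\Omega_{\mathcal O})\bigr).$$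
   Context: The ground field is algebraically closed of characteristic $0$. $\mathfrak g=\mathrm{Lie}\,G$, $\mathfrak h=\mathrm{Lie}\,H$, and $\mathfrak m=\mathfrak h^\perp$ is the orthogonal complement with respect to the Killing form of $\mathfrak g$. The condition $\overline{\mathcal O}\cap\mathfrak m=\{0\}$ implies that $H$ has a dense orbit $\Omega_{\mathcal O}$ in $\mathcal O$. For a nonzero nilpotent $e\in\mathfrak h$, $\mathrm{ht}_H(H\cdot e)=\max\{k\mid(\mathrm{ad}_{\mathfrak h}e)^k\ne0\}$ and $\mathrm{ht}_G(G\cdot e)=\max\{k\mid(\mathrm{ad}_{\mathfrak g}e)^k\neq0\}$. *)

(* Defs.v *)
From HB Require Import structures.
From mathcomp Require Import all_boot all_order all_algebra.
From mathcomp Require Import boolp classical_sets.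
From mathcomp Require Import mpoly.

Set Implicit Arguments.
Unset Strict Implicit.
Unset Printing Implicit Defensive.

Import GRing.Theory passmx.
Local Open Scope ring_scope.
Local Open Scope classical_set_scope.

(* The subspace with carrier P, when P is closed under linear combinations;
   see vspace_ofP. *)
Definition vspace_of (K : fieldType) (vT : vectType K) (P : set vT) :
  {vspace vT} := xget 0%VS [set U : {vspace vT} | [set x | x \in U] = P].

Lemma vspace_ofP (K : fieldType) (vT : vectType K) (P : set vT) :
  P 0 -> (forall a u v, P u -> P v -> P (a *: u + v)) ->
  forall x, x \in vspace_of P <-> P x.
Proof.
move=> P0 Plin.
suff [U defU] : exists U : {vspace vT}, [set x | x \in U] = P.
  have E : [set x | x \in vspace_of P] = P.
    exact: (@xgetPex _ 0%VS [set U : {vspace vT} | [set x | x \in U] = P]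
              (ex_intro _ U defU)).
  by move=> x; rewrite -{2}E.
pose sub (U : {vspace vT}) := forall x, x \in U -> P x.
pose d i := `[< exists2 U, sub U & \dim U = i >].
have d0 : exists i, d i.
  exists 0%N; apply/asboolP; exists 0%VS; last by rewrite dimv0.
  by move=> x; rewrite memv0 => /eqP ->.
have dmax i : d i -> (i <= \dim {: vT})%N.
  by case/asboolP => U _ <-; apply/dimvS/subvf.
case: (ex_maxnP d0 dmax) => i /asboolP[U sU dU] max_i.
exists U; apply/seteqP; split => [x /sU //|x Px /=].
apply: contraT => xNU.
have sUx : sub (<[x]> + U)%VS.
  move=> y /memv_addP[_ /vlineP[a ->] [u uU ->]].
  by apply: Plin => //; exact: sU.
have /max_i : d (\dim (<[x]> + U)%VS) by apply/asboolP; exists (<[x]> + U)%VS.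
rewrite -dU => le_dim.
have /eqP eqU : U == (<[x]> + U)%VS by rewrite eqEdim addvSr le_dim.
by case/negP: xNU; rewrite eqU; exact: (subvP (addvSl _ _)) (memv_line x).
Qed.

Section MatrixGroups.
Variables (k : closedFieldType) (n : nat).
Implicit Types (G H N S A B : set 'M[k]_n) (V U : {vspace 'M[k]_n}).
Implicit Types (x y z g X : 'M[k]_n) (f : {mpoly k[(n * n)]}).

(* A polynomial function of the n * n matrix entries. *)
Definition peval f x : k := f.@[mxvec x 0].

Definition vanishes_on f S := forall x, S x -> peval f x = 0.

(* Zariski closure in the affine space of all n x n matrices. *)
Definition zclosure S : set 'M[k]_n :=
  [set x | forall f, vanishes_on f S -> peval f x = 0].

Definition zclosed S := zclosure S `<=` S.

Definition zconnected S := forall A B, zclosed A -> zclosed B ->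
  S `<=` A `|` B -> S `&` (A `&` B) = set0 -> S `<=` A \/ S `<=` B.

Definition subgroup_GL G :=
  [/\ forall g, G g -> g \in unitmx,
      G 1%:M,
      forall g1 g2, G g1 -> G g2 -> G (g1 *m g2)
    & forall g, G g -> G (invmx g)].

(* Linear algebraic group: a subgroup of GL_n closed in GL_n (not necessarily
   in the space of all matrices). *)
Definition algebraic_group G :=
  subgroup_GL G /\ zclosure G `&` [set g | g \in unitmx] `<=` G.

Definition normal_in N G := N `<=` G /\
  forall g x, G g -> N x -> N (g *m x *m invmx g).

Definition commutator_subgroup G : set 'M[k]_n :=
  \bigcap_(K in [set K | subgroup_GL K /\
     forall x y, G x -> G y -> K (x *m y *m invmx x *m invmx y)]) K.

Definition solvable_group G :=
  exists d, iter d commutator_subgroup G `<=` [set 1%:M].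

(* Simple as an algebraic group; the centre may be a nontrivial finite group. *)
Definition simple_algebraic_group G :=
  [/\ algebraic_group G, zconnected G,
      exists x y, [/\ G x, G y & x *m y != y *m x]
    & forall N, algebraic_group N -> zconnected N -> normal_in N G ->
        N = [set 1%:M] \/ N = G].

(* Connected with trivial radical. *)
Definition connected_semisimple_group H :=
  [/\ algebraic_group H, zconnected H
    & forall N, algebraic_group N -> zconnected N -> normal_in N H ->
        solvable_group N -> N = [set 1%:M]].

(* The differential at 1%:M, in the direction X, of the function peval f. *)
Definition diff1 f X : k :=
  \sum_(i < n * n) peval (mderiv i f) 1%:M * mxvec X 0 i.

(* Lie G inside gl_n, as the tangent space of G at 1%:M. *)
Definition lie G : {vspace 'M[k]_n} :=
  vspace_of [set X | forall f, vanishes_on f G -> diff1 f X = 0].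

Lemma lieP G X :
  X \in lie G <-> forall f, vanishes_on f G -> diff1 f X = 0.
Proof.
apply: vspace_ofP => [f _|a u v Pu Pv f fG].
  by rewrite /diff1 big1 // => i _; rewrite linear0 mxE mulr0.
rewrite /diff1.
under eq_bigr => i _ do rewrite linearP !mxE mulrDr mulrCA.
by rewrite big_split -mulr_sumr /= -!/(diff1 _ _) Pu // Pv // mulr0 addr0.
Qed.

Definition bracket x y : 'M[k]_n := x *m y - y *m x.

(* The adjoint endomorphism of x on the Lie subalgebra V of gl_n, meant for x
   in V: the bracket then lies in V, where vsproj is inverse to vsval. *)
Definition ad V x : 'End(subvs_of V) :=
  linfun (fun y : subvs_of V => vsproj V (bracket x (vsval y))).

Lemma bracket_linearr a x y z :
  bracket x (a *: y + z) = a *: bracket x y + bracket x z.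
Proof.
rewrite /bracket mulmxDr mulmxDl -scalemxAr -scalemxAl.
by rewrite scalerBr opprD addrACA.
Qed.

Lemma bracket_linearl a x y z :
  bracket (a *: x + y) z = a *: bracket x z + bracket y z.
Proof.
rewrite /bracket mulmxDr mulmxDl -scalemxAr -scalemxAl.
by rewrite scalerBr opprD addrACA.
Qed.

Lemma adE V x (y : subvs_of V) :
  ad V x y = vsproj V (bracket x (vsval y)).
Proof.
pose F (z : subvs_of V) := vsproj V (bracket x (vsval z)).
have lF : linear F by move=> a u v; rewrite /F linearP bracket_linearr linearP.
pose F' : {linear subvs_of V -> subvs_of V} :=
  HB.pack F (GRing.isLinear.Build _ _ _ _ F lF).
exact: (lfunE F' y).
Qed.

Lemma ad_linear V a x y : ad V (a *: x + y) = a *: ad V x + ad V y.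
Proof.
apply/lfunP => z.
by rewrite add_lfunE scale_lfunE !adE bracket_linearl linearP.
Qed.

Definition killing V x y : k := 
  let e := vbasis {: subvs_of V} in \tr (mxof e e (ad V x \o ad V y)%VF).

Lemma killing_linearl V a x y z :
  killing V (a *: x + y) z = a * killing V x z + killing V y z.
Proof. by rewrite /killing ad_linear comp_lfunDl -comp_lfunZl !linearP. Qed.

(* The orthogonal complement of U in V for the Killing form of V. *)
Definition killing_perp V U : {vspace 'M[k]_n} :=
  vspace_of [set x | x \in V /\ forall y, y \in U -> killing V x y = 0].

Lemma killing_perpP V U x : x \in killing_perp V U <->
  x \in V /\ forall y, y \in U -> killing V x y = 0.
Proof.
apply: vspace_ofP => [|a u v [uV Pu] [vV Pv]].
  split=> [|y _]; first exact: mem0v.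
  have := killing_linearl V (-1) 0 0 y.
  by rewrite scaler0 addr0 mulN1r addNr.
split=> [|y yU]; first by rewrite memvD // memvZ.
by rewrite killing_linearl Pu // Pv // mulr0 addr0.
Qed.

(* G . S for the adjoint action; the orbit of x is adj_sat G [set x]. *)
Definition adj_sat G S : set 'M[k]_n :=
  [set g *m x *m invmx g | g in G & x in S].

(* Nilpotent elements of Lie G are those which are nilpotent as matrices. *)
Definition nilpotent_mx x := exists m : nat, x ^+ m = 0.

Definition nonzero_nilpotent_orbit G S := exists x,
  [/\ x \in lie G, x != 0, nilpotent_mx x & S = adj_sat G [set x]].

Definition dense_orbit H S T :=
  [/\ exists x, T = adj_sat H [set x], T `<=` S & S `<=` zclosure T].

Definition lfun_pow (vT : vectType k) (u : 'End(vT)) (j : nat) : 'End(vT) :=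
  iter j (comp_lfun u) \1%VF.

Definition is_height V x j := lfun_pow (ad V x) j != 0 /\
  forall i, lfun_pow (ad V x) i != 0 -> (i <= j)%N.

(* The elements of an orbit share the same height, that of the orbit. *)
Definition is_orbit_height V S j := forall x, S x -> is_height V x j.

End MatrixGroups.

(* Main.v *)
Require Import Defs.
From HB Require Import structures.
From mathcomp Require Import all_boot all_order all_algebra.
From mathcomp Require Import boolp classical_sets.
From mathcomp Require Import mpoly.
From mathcomp Require Import ring zify.

(** Let [e] be in the dense [H]-orbit [Omega], let [a = phi e], and let [N] be
    the height of [a] in [g]. If [(ad a)^N] vanished on [h], then it would map
    [g] into [m]. For [x] in [Orb] the curve [t |-> exp (t ad a) x] lies in the
    closure of [Orb], which is a cone, so its leading coefficient, a multiple
    of [(ad a)^N x], lies in that closure and in [m], hence is [0]. It remains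
    to see that [(ad a)^N] does not kill [Orb].

    - The matrix [a] is nilpotent because the traces of its powers extend to
      regular functions, constant on [Omega], hence on a closed set containing
      [0].
    - For a nonzero nilpotent [x] in [g], the group [G] is the closure of the
      group generated by the conjugates of [exp (t x)], by simplicity; it follows
      that every [G]-stable subspace of [g] containing [x] contains [[g, g]].
    - The Killing form of [g] is nondegenerate on [h], since [h] and its
      orthogonal [m] intersect in [0], so [a] lies in a pair [a, c = [a, z]] of
      elements of [h] with [[c, a] = 2 a]; then
      [(ad a)^N [c, y] = - N (ad a)^N y], so [(ad a)^N] does not kill [[g, g]],
      and hence does not kill [Orb].
    - For [Orb] to have a conical closure it is enough that every [x] in [Orb]
      lies in [[g, x]]. As [x] is Killing-orthogonal to its centralizer, this
      holds up to an element [r] of the radical of the Killing form. That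
      radical contains no nonzero nilpotent, which would generate an ideal
      containing [[g, g]] and [a]; it follows that it is central, and that [r],
      whose powers have trace [0], vanishes. *)

Set Implicit Arguments.
Unset Strict Implicit.
Unset Printing Implicit Defensive.

Import GRing.Theory passmx.
Local Open Scope ring_scope.
Local Open Scope classical_set_scope.

(** * Nilpotent matrices and traces of powers in characteristic zero *)

Section Nilpotent.
Variables (k : closedFieldType) (char0 : [pchar k] =i pred0).

Lemma natf_neq0_char0 j : j.+1%:R != 0 :> k.
Proof. by move/pcharf0P: char0 => ->. Qed.

(** A rank factorization [E = L *m R] has [L] left invertible and [R] right invertible, so
    idempotence forces [R *m L = 1], and the trace of [R *m L] is the rank. *)
Lemma mxtrace_idem n (E : 'M[k]_n) : E *m E = E -> \tr E = (\rank E)%:R.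
Proof.
move=> idE; rewrite -{1}(mulmx_base E) mxtrace_mulC.
have RL1 r (L : 'M[k]_(n, r)) (R B : 'M[k]_(r, n)) C : B *m L = 1%:M -> R *m C = 1%:M ->
    L *m R *m (L *m R) = L *m R -> R *m L = 1%:M.
  move=> BL RC /(congr1 (fun Z => B *m Z *m C)).
  by rewrite !mulmxA BL !mul1mx -!mulmxA RC mulmx1.
have /row_freeP[B colB] : row_free (col_base E)^T.
  by rewrite /row_free mxrank_tr; apply: col_base_full.
have /row_freeP[C rowC] := row_base_free E.
rewrite (RL1 _ _ _ (B : 'M[k]_(n, _))^T C) ?mxtrace1 ?mulmx_base //.
by apply: trmx_inj; rewrite trmx_mul trmxK colB trmx1.
Qed.

(** Fitting's decomposition: Bezout applied to ['X ^+ m.+1] and the factor [q] of the characteristic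
    polynomial prime to ['X] yields the idempotent onto the part where [A] is invertible. It is a
    polynomial in [A] without constant term, so its trace is 0, and in characteristic zero its rank
    is 0. *)
Lemma nilpotent_trX n (A : 'M[k]_n) :
  (forall j, \tr (A ^+ j.+1) = 0) -> nilpotent_mx A.
Proof.
case: n A => [A _|n A trA]; first by exists 0%N; rewrite [LHS]flatmx0 [RHS]flatmx0.
have tr0 (p : {poly k}) : \tr (horner_mx A (p * 'X)) = 0.
  rewrite rmorphM /= horner_mx_X -[p in horner_mx A p]coefK poly_def raddf_sum /=.
  rewrite mulr_suml raddf_sum /=.
  apply: big1 => i _; rewrite linearZ /= -scalerAl linearZ /=.
  by rewrite rmorphXn /= horner_mx_X -exprSr trA mulr0.
have [m [q rq chiE]] := multiplicity_XsubC (char_poly A) 0.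
have {}rq : ~~ root q 0 by move: rq; rewrite monic_neq0 ?char_poly_monic.
(* The exponent [m.+1] instead of [m] keeps [u * 'X ^+ m.+1] divisible by ['X] when [m = 0]. *)
have [u [v uv1]] : exists u v : {poly k}, u * 'X ^+ m.+1 + v * q = 1.
  have : coprimep ('X ^+ m.+1) q.
    by apply: coprimep_expl; rewrite coprimep_sym coprimepX.
  by case/Bezout_eq1_coprimepP=> -[u v] uv1; exists u, v.
rewrite polyC0 subr0 in chiE.
have vq0 : horner_mx A ('X ^+ m.+1 * (v * q)) = 0.
  rewrite exprS -mulrA [X in _ * X](_ : _ = v * char_poly A).
    by rewrite !rmorphM /= Cayley_Hamilton !mulr0.
  by rewrite chiE; ring.
pose E := horner_mx A (u * 'X ^+ m.+1).
have idE : E *m E = E.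
  rewrite mulmxE -rmorphM /= -[RHS]subr0 -(mulr0 (horner_mx A u)) -vq0 -rmorphM -rmorphB.
  congr (horner_mx A _); have -> : v * q = 1 - u * 'X ^+ m.+1 by rewrite -uv1; ring.
  ring.
have /eqP : \tr E = 0 by rewrite /E exprSr mulrA tr0.
rewrite mxtrace_idem // => rkE.
have {rkE} E0 : E = 0.
  by apply/eqP; rewrite -mxrank_eq0; move/pcharf0P: char0 => <-.
have vq1 : horner_mx A (v * q) = 1.
  by rewrite -[LHS]add0r -[X in X + _]E0 -rmorphD uv1 rmorph1.
exists m.+1; move: vq0.
by rewrite rmorphM /= vq1 mulr1 rmorphXn /= horner_mx_X.
Qed.

(** Every eigenvalue is 0, so the characteristic polynomial is a power of ['X], and the trace is
    minus its subleading coefficient. *)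
Lemma nilpotent_mxtrace0 n (A : 'M[k]_n) : nilpotent_mx A -> \tr A = 0.
Proof.
case: n A => [|n] A [m Am]; first by rewrite /mxtrace big_ord0.
have eig0 z : eigenvalue A z -> z = 0.
  case/eigenvalueP=> v vA nz_v.
  have vAm j : v *m A ^+ j = z ^+ j *: v.
    elim: j => [|j IHj]; first by rewrite !expr0 mulmx1 scale1r.
    by rewrite !exprSr -mulmxE mulmxA IHj -scalemxAl vA scalerA.
  move: (vAm m); rewrite Am mulmx0 => /esym/eqP; rewrite scaler_eq0 (negPf nz_v) orbF.
  by rewrite expf_eq0 => /andP[_ /eqP].
have [r chiE] := closed_field_poly_normal (char_poly A).
have szr : size r = n.+1.
  have := size_char_poly A.
  by rewrite chiE (monicP (char_poly_monic A)) scale1r size_prod_XsubC => -[].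
have chiX : char_poly A = 'X ^+ n.+1.
  rewrite chiE (monicP (char_poly_monic A)) scale1r.
  rewrite (eq_big_seq (fun=> 'X)) ?big_const_seq ?count_predT ?szr ?iter_mulr_1 // => z rz.
  rewrite (eig0 z) ?polyC0 ?subr0 // eigenvalue_root_char chiE.
  by rewrite (monicP (char_poly_monic A)) scale1r root_prod_XsubC.
apply: oppr_inj; rewrite -char_poly_trace // chiX coefXn /= oppr0.
by rewrite eqn_leq ltnn andbF.
Qed.

End Nilpotent.

(** * Products with a nilpotent element that commutes with the commutator *)

Section CommutingCommutator.
Variables (R : pzRingType) (u v w : R).
Hypotheses (defw : u * v - v * u = w) (comm_uw : GRing.comm u w).

Lemma exprM_commr i : u ^+ i.+1 * v = v * u ^+ i.+1 + (w * u ^+ i) *+ i.+1.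
Proof.
have uv : u * v = v * u + w by rewrite -defw addrC subrK.
elim: i => [|i IHi]; first by rewrite !expr1 mulr1.
rewrite exprSr -mulrA uv mulrDr mulrA IHi mulrDl -mulrA -exprSr -addrA; congr (_ + _).
rewrite -mulrnAl -mulrA -exprSr mulrnAl -(commrX _ (commr_sym comm_uw)).
by rewrite [RHS]mulrS addrC.
Qed.

(* The Kleinecke-Shirokov argument: each step lowers the power of [u] in
   [w ^+ p * u ^+ j] at the cost of raising that of [w]. *)
Lemma nilpotent_commutator r : (forall j (x : R), x *+ j.+1 = 0 -> x = 0) ->
  u ^+ r = 0 -> exists p, w ^+ p = 0.
Proof.
move=> tf ur; have : w ^+ 0 * u ^+ r = 0 by rewrite ur mulr0.
move: 0%N; elim: r {ur} => [p|j IHj p wu0]; first by rewrite mulr1; exists p.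
have uw0 : u ^+ j.+1 * w ^+ p = 0.
  by rewrite (commrX p (commr_sym (commrX j.+1 (commr_sym comm_uw)))).
have := exprM_commr j => /(congr1 (fun z => w ^+ p * z * w ^+ p)).
rewrite !mulrA wu0 mul0r mulrDr mulrDl -!mulrA uw0 !mulr0 add0r.
move=> /esym; rewrite mulrnAl mulrnAr mul0r => /tf wuw; apply: (IHj (p + p).+1).
have uw : u ^+ j * w ^+ p = w ^+ p * u ^+ j.
  by rewrite (commrX p (commr_sym (commrX j (commr_sym comm_uw)))).
by rewrite -[RHS]wuw -(mulrA w) uw exprS exprD !mulrA -exprSr exprS.
Qed.

(** [u * v] preserves the kernel of [u ^+ i.+1], and there [u ^+ i] turns it into multiplication by
    [i.+1] times [w]. So [M] applications lead from this kernel into that of [u ^+ i]. *)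
Lemma nilpotent_mulr_ker M i (x : R) : w ^+ M = 0 -> u ^+ i * x = 0 ->
  (u * v) ^+ (M * i) * x = 0.
Proof.
move=> wM; elim: i x => [|i IHi] x ux; first by rewrite muln0.
have step y : u ^+ i.+1 * y = 0 ->
    u ^+ i.+1 * (u * v * y) = 0 /\ u ^+ i * (u * v * y) = (w * (u ^+ i * y)) *+ i.+1.
  move=> uy; have uy2 : u ^+ i.+2 * y = 0 by rewrite exprS -mulrA uy mulr0.
  split.
    rewrite !mulrA -exprSr exprM_commr mulrDl mulrnAl -(mulrA v) uy2 -(mulrA w) uy.
    by rewrite !mulr0 mul0rn addr0.
  by rewrite !mulrA -exprSr exprM_commr mulrDl mulrnAl -!mulrA uy mulr0 add0r.
have stepn p : u ^+ i.+1 * ((u * v) ^+ p * x) = 0 /\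
    u ^+ i * ((u * v) ^+ p * x) = (w ^+ p * (u ^+ i * x)) *+ (i.+1 ^ p).
  elim: p => [|p [IH1 IH2]]; first by rewrite !mul1r.
  rewrite [(u * v) ^+ p.+1]exprS -[u * v * _ * x]mulrA; have [-> ->] := step _ IH1; split=> //.
  by rewrite IH2 mulrnAr -mulrnA mulrA -exprS expnSr.
have [_] := stepn M; rewrite wM mul0r mul0rn => /IHi.
by rewrite mulrA -exprD mulnS addnC.
Qed.

End CommutingCommutator.

Section Trace.
Variables (k : closedFieldType) (char0 : [pchar k] =i pred0).

Lemma mulrn_mx_inj0 p q j (x : 'M[k]_(p, q)) : x *+ j.+1 = 0 -> x = 0.
Proof.
rewrite -scaler_nat => /eqP; rewrite scaler_eq0.
by rewrite (negPf (natf_neq0_char0 char0 j)) => /eqP.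
Qed.

(** The commutator is nilpotent by the Kleinecke-Shirokov argument, and [nilpotent_mulr_ker] at
    [x = 1] then makes [u * v] itself nilpotent. *)
Lemma mxtrace_mul_nilpotent n (u v : 'M[k]_n) : nilpotent_mx u ->
  u * (u * v - v * u) = (u * v - v * u) * u -> \tr (u * v) = 0.
Proof.
move=> [r ur] uw; apply: nilpotent_mxtrace0.
have [M wM] := nilpotent_commutator erefl uw (@mulrn_mx_inj0 n n) ur.
exists (M * r)%N; rewrite -[LHS]mulr1.
by apply: (nilpotent_mulr_ker erefl uw wM); rewrite ur mul0r.
Qed.

End Trace.

(** * Double orthogonals for a possibly degenerate form *)

(** The functional [B _ a] on [V] vanishes wherever all [B _ u] with [u] in [U] vanish, so it is a
    combination of them. This locates [a] in [U] up to an element of the radical. *)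
Lemma mem_double_perp (k : fieldType) (vT : vectType k) (B : vT -> vT -> k)
    (V U : {vspace vT}) (a : vT) :
  (forall c x y z, B (c *: x + y) z = c * B x z + B y z) ->
  (forall c x y z, B z (c *: x + y) = c * B z x + B z y) ->
  a \in V -> (U <= V)%VS ->
  (forall y, y \in V -> (forall u, u \in U -> B y u = 0) -> B y a = 0) ->
  exists2 u, u \in U & a - u \in V /\ forall y, y \in V -> B y (a - u) = 0.
Proof.
move=> Bl Br aV sUV perp_a.
have Bl0 z : B 0 z = 0 by have := Bl (-1) 0 0 z; rewrite scaler0 addr0 mulN1r addNr.
have Br0 z : B z 0 = 0 by have := Br (-1) 0 0 z; rewrite scaler0 addr0 mulN1r addNr.
pose b := vbasis V; pose bU := vbasis U.
have Bsuml I (r : seq I) (c : I -> k) (v : I -> vT) z :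
    B (\sum_(i <- r) c i *: v i) z = \sum_(i <- r) c i * B (v i) z.
  elim: r => [|i r IHr]; first by rewrite !big_nil Bl0.
  by rewrite !big_cons Bl IHr.
have Bsumr I (r : seq I) (c : I -> k) (v : I -> vT) z :
    B z (\sum_(i <- r) c i *: v i) = \sum_(i <- r) c i * B z (v i).
  elim: r => [|i r IHr]; first by rewrite !big_nil Br0.
  by rewrite !big_cons Br IHr.
pose M := \matrix_(j < \dim U, i < \dim V) B b`_i bU`_j.
pose th := \row_(i < \dim V) B b`_i a.
have : (th <= M)%MS.
  rewrite submxE; apply/eqP/rowP=> l; rewrite !mxE.
  (* A column of the cokernel of [M] gives the coordinates of a vector of [V] orthogonal to [U]. *)
  pose c i := cokermx M i l; pose y := \sum_i c i *: b`_i.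
  have yV : y \in V.
    by apply: memv_suml => i _; rewrite memvZ // vbasis_mem ?mem_nth ?size_tuple.
  have By z : B y z = \sum_i c i * B b`_i z by rewrite Bsuml.
  rewrite -[RHS](perp_a y yV) ?By; first by apply: eq_bigr => i _; rewrite mxE mulrC.
  move=> u uU; rewrite (coord_vbasis uU) Bsumr big1 // => j _.
  have := congr1 (fun X : 'M_(_, _) => X j l) (mulmx_coker M); rewrite !mxE => MC.
  rewrite By [X in _ * X](_ : _ = 0) ?mulr0 //.
  by rewrite -[RHS]MC; apply: eq_bigr => i _; rewrite mxE mulrC.
case/submxP=> D thE.
exists (\sum_j D 0 j *: bU`_j).
  by apply: memv_suml => j _; rewrite memvZ // vbasis_mem ?mem_nth ?size_tuple.
set u := \sum_j _.
have uU : u \in U.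
  by apply: memv_suml => j _; rewrite memvZ // vbasis_mem ?mem_nth ?size_tuple.
split; first by rewrite memvB // (subvP sUV).
move=> y yV; rewrite (coord_vbasis yV) Bsuml big1 // => i _.
suff -> : B (vbasis V)`_i (a - u) = 0 by rewrite mulr0.
rewrite -[a]scale1r -scaleN1r addrC Br mulN1r addrC.
rewrite scale1r Bsumr.
have := congr1 (fun X : 'rV_(\dim V) => X 0 i) thE; rewrite !mxE => ->.
apply/eqP; rewrite subr_eq0; apply/eqP/eq_bigr => j _; by rewrite mxE.
Qed.

(** * Regular functions and Zariski closure *)

Section RegularFunctions.
Variables (k : closedFieldType) (n : nat).
Implicit Types (F : 'M[k]_n -> k) (f : {mpoly k[(n * n)]}).

Definition regular F := exists f, forall x, peval f x = F x.

Lemma regular_peval f : regular (peval f).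
Proof. by exists f. Qed.

Lemma regular_ext F1 F2 : F1 =1 F2 -> regular F1 -> regular F2.
Proof. by move=> eqF [f fE]; exists f => x; rewrite fE eqF. Qed.

Lemma regular_const c : regular (fun=> c).
Proof. by exists c%:MP => x; rewrite /peval mevalC. Qed.

Lemma regular_entry i j : regular (fun x => x i j).
Proof. by exists 'X_(mxvec_index i j) => x; rewrite /peval mevalXU mxvecE. Qed.

Lemma regularD F1 F2 : regular F1 -> regular F2 -> regular (fun x => F1 x + F2 x).
Proof. by move=> [f fE] [g gE]; exists (f + g) => x; rewrite /peval mevalD -fE -gE. Qed.

Lemma regularM F1 F2 : regular F1 -> regular F2 -> regular (fun x => F1 x * F2 x).
Proof. by move=> [f fE] [g gE]; exists (f * g) => x; rewrite /peval mevalM -fE -gE. Qed.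

Lemma regularN F : regular F -> regular (fun x => - F x).
Proof. by move=> [f fE]; exists (- f) => x; rewrite /peval mevalN -fE. Qed.

Lemma regularB F1 F2 : regular F1 -> regular F2 -> regular (fun x => F1 x - F2 x).
Proof. by move=> r1 r2; apply: regularD => //; apply: regularN. Qed.

Lemma regular_sum I (r : seq I) (F : I -> 'M[k]_n -> k) :
  (forall i, regular (F i)) -> regular (fun x => \sum_(i <- r) F i x).
Proof.
move=> rF; elim: r => [|i r IHr].
  by apply: regular_ext (regular_const 0) => x; rewrite big_nil.
by apply: regular_ext (regularD (rF i) IHr) => x; rewrite big_cons.
Qed.

Lemma regular_prod I (r : seq I) (F : I -> 'M[k]_n -> k) :
  (forall i, regular (F i)) -> regular (fun x => \prod_(i <- r) F i x).
Proof.
move=> rF; elim: r => [|i r IHr].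
  by apply: regular_ext (regular_const 1) => x; rewrite big_nil.
by apply: regular_ext (regularM (rF i) IHr) => x; rewrite big_cons.
Qed.

Definition regular_mx p q (T : 'M[k]_n -> 'M[k]_(p, q)) :=
  forall i j, regular (fun x => T x i j).

Lemma regular_mx_id : regular_mx id.
Proof. by move=> i j; apply: regular_entry. Qed.

Lemma regular_mx_const p q (y : 'M[k]_(p, q)) : regular_mx (fun=> y).
Proof. by move=> i j; apply: regular_const. Qed.

Lemma regular_mxM p q r (T : 'M[k]_n -> 'M[k]_(p, q)) (T' : 'M[k]_n -> 'M[k]_(q, r)) :
  regular_mx T -> regular_mx T' -> regular_mx (fun x => T x *m T' x).
Proof.
move=> rT rT' i j; apply: (@regular_ext (fun x => \sum_l T x i l * T' x l j)).
  by move=> x; rewrite mxE.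
by apply: regular_sum => l; apply: regularM.
Qed.

Lemma regular_mxB p q (T T' : 'M[k]_n -> 'M[k]_(p, q)) :
  regular_mx T -> regular_mx T' -> regular_mx (fun x => T x - T' x).
Proof.
move=> rT rT' i j; apply: (@regular_ext (fun x => T x i j - T' x i j)).
  by move=> x; rewrite !mxE.
exact: regularB.
Qed.

Lemma regular_det p (T : 'M[k]_n -> 'M[k]_p) :
  regular_mx T -> regular (fun x => \det (T x)).
Proof.
move=> rT; rewrite /determinant; apply: regular_sum => s; apply: regularM.
  exact: regular_const.
by apply: regular_prod => i; apply: rT.
Qed.

Lemma regular_mx_adj p (T : 'M[k]_n -> 'M[k]_p) :
  regular_mx T -> regular_mx (fun x => \adj (T x)).
Proof.
move=> rT i j; apply: (@regular_ext (fun x => cofactor (T x) j i)).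
  by move=> x; rewrite mxE.
rewrite /cofactor; apply: regularM; first exact: regular_const.
apply: regular_det => a b; apply: regular_ext (rT (lift j a) (lift i b)) => x.
by rewrite !mxE.
Qed.

Lemma regular_linear p q (T : {linear 'M[k]_n -> 'M[k]_(p, q)}) : regular_mx T.
Proof.
move=> a b; apply: (@regular_ext (fun x => \sum_i \sum_j x i j * T (delta_mx i j) a b)).
  move=> x; rewrite [in RHS](matrix_sum_delta x) linear_sum summxE.
  by apply: eq_bigr => i _; rewrite linear_sum summxE; apply: eq_bigr => j _; rewrite linearZ mxE.
apply: regular_sum => i; apply: regular_sum => j.
by apply: regularM; [apply: regular_entry|apply: regular_const].
Qed.

Lemma regular_comp F (T : 'M[k]_n -> 'M[k]_n) :
  regular F -> regular_mx T -> regular (fun x => F (T x)).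
Proof.
move=> [f fE] rT.
have /boolp.choice[t tE] : forall l : 'I_(n * n), exists g, forall x,
    peval g x = mxvec (T x) 0 l.
  by case/mxvec_indexP=> i j; have [g gE] := rT i j; exists g => x; rewrite gE mxvecE.
exists (f \mPo [tuple t l | l < n * n]) => x; rewrite -fE /peval comp_mpoly_meval.
by apply: meval_eq => l; rewrite tnth_mktuple; apply: tE.
Qed.

Lemma regular_mxtrace (T : 'M[k]_n -> 'M[k]_n) : regular_mx T -> regular (fun x => \tr (T x)).
Proof. by move=> rT; apply: regular_sum => i; apply: rT. Qed.

Lemma zclosure_regular (S : set 'M[k]_n) x F : zclosure S x -> regular F ->
  (forall y, S y -> F y = 0) -> F x = 0.
Proof. by move=> Sx [f fE] F0; rewrite -fE; apply: Sx => y /F0; rewrite fE. Qed.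

Lemma zclosure_regular_mx (S : set 'M[k]_n) x p q (T : 'M[k]_n -> 'M[k]_(p, q)) : zclosure S x ->
  regular_mx T -> (forall y, S y -> T y = 0) -> T x = 0.
Proof.
move=> Sx rT T0; apply/matrixP=> i j; rewrite [RHS]mxE.
by apply: (zclosure_regular Sx (rT i j)) => y /T0->; rewrite mxE.
Qed.

Lemma sub_zclosure (S : set 'M[k]_n) : S `<=` zclosure S.
Proof. by move=> x Sx f; apply. Qed.

Lemma zclosureS (S T : set 'M[k]_n) : S `<=` zclosure T -> zclosure S `<=` zclosure T.
Proof. by move=> ST x Sx f fT; apply: Sx => y /ST; apply. Qed.

End RegularFunctions.

(** * Polynomial curves of matrices and their derivatives *)

Section Curves.
Variables (k : closedFieldType) (char0 : [pchar k] =i pred0) (n : nat).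
Implicit Types (f : {mpoly k[(n * n)]}) (C : 'M[{poly k}]_n) (x y : 'M[k]_n) (p q : {poly k}).

(** The images of [0, ..., size p - 1] in [k] are distinct, and a nonzero [p] cannot have that many
    roots. *)
Lemma poly_eq0_char0 p : (forall t, p.[t] = 0) -> p = 0.
Proof.
move=> p0; apply/eqP/negPn/negP => nz_p.
pose r := [seq j%:R : k | j <- iota 0 (size p)].
have := @max_poly_roots k p r nz_p; rewrite size_map size_iota ltnn => /(_ _ _) H.
apply: notF; apply: H; first by apply/allP=> z _; apply/eqP/p0.
rewrite map_inj_uniq ?iota_uniq // => i j.
have inj (a b : nat) : (a <= b)%N -> a%:R = b%:R :> k -> a = b.
  move=> ab /eqP; rewrite eq_sym -subr_eq0 -natrB //.
  by move/pcharf0P: char0 => ->; rewrite subn_eq0 => ba; apply/eqP; rewrite eqn_leq ab.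
by case: (leqP i j) => [|/ltnW] ij E; [apply: inj|apply/esym/inj].
Qed.

Lemma poly_ext_char0 p q : (forall t, p.[t] = q.[t]) -> p = q.
Proof.
move=> pq; apply/eqP; rewrite -subr_eq0; apply/eqP/poly_eq0_char0 => t.
by rewrite hornerD hornerN pq subrr.
Qed.

Lemma deriv_eq0_char0 p : p^`() = 0 -> p = (p`_0)%:P.
Proof.
move=> p'; apply/polyP=> -[|i]; rewrite coefC //=.
have := congr1 (fun q => q`_i) p'; rewrite coef_deriv coef0 => /eqP.
by rewrite -mulr_natl mulf_eq0 (negPf (natf_neq0_char0 char0 i)) => /eqP.
Qed.

(* A polynomial curve in the space of matrices is a matrix over [{poly k}]. *)
Definition ev (t : k) a b (C : 'M[{poly k}]_(a, b)) : 'M[k]_(a, b) := map_mx (horner_eval t) C.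
Definition dmx a b (C : 'M[{poly k}]_(a, b)) := map_mx (@deriv k) C.

Definition along f C : {poly k} := mmap polyC (fun i => mxvec C 0 i) f.

(** The differential of [peval f] at [x]; [diff1] is the case [x = 1%:M]. *)
Definition diffat f x X : k := \sum_(i < n * n) peval (mderiv i f) x * mxvec X 0 i.

Lemma mpoly_alg_ind (P : {mpoly k[(n * n)]} -> Prop) : (forall c, P c%:MP) -> (forall i, P 'X_i) ->
  (forall f1 f2, P f1 -> P f2 -> P (f1 + f2)) -> (forall f1 f2, P f1 -> P f2 -> P (f1 * f2)) ->
  forall f, P f.
Proof.
move=> PC PX PD PM; elim/mpolyind => [|c m f _ _ Pf]; first by rewrite -mpolyC0.
apply: PD => //; rewrite -mul_mpolyC; apply: (PM) => //.
rewrite mpolyXE_id; apply: big_ind => [||i _]; [by rewrite -mpolyC1|exact: (PM)|].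
elim: (m i) => [|j IHj]; first by rewrite expr0 -mpolyC1.
by rewrite exprS; apply: PM.
Qed.

Lemma along_ev f C t : (along f C).[t] = peval f (ev t C).
Proof.
rewrite /along /peval; elim/mpoly_alg_ind: f => [c|i|f1 f2 IH1 IH2|f1 f2 IH1 IH2].
- by rewrite mmapC mevalC hornerC.
- rewrite mevalXU mmapX mmap1U; case/mxvec_indexP: i => i j.
  by rewrite !mxvecE mxE.
- by rewrite mmapD mevalD hornerD IH1 IH2.
- by rewrite rmorphM mevalM hornerM IH1 IH2.
Qed.

(** The chain rule. Both sides obey the Leibniz rule in [f], so it is enough that they agree on
    constants and variables. *)
Lemma deriv_along f C t : (along f C)^`().[t] = diffat f (ev t C) (ev t (dmx C)).
Proof.
rewrite /diffat.
elim/mpoly_alg_ind: f => [c|i|f1 f2 IH1 IH2|f1 f2 IH1 IH2].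
- rewrite /along mmapC derivC horner0 big1 // => l _.
  by rewrite mderivC /peval meval0 mul0r.
- rewrite /along mmapX mmap1U (bigD1 i) //= big1 ?addr0 => [|l nli]; last first.
    by rewrite mderivX mnm1E eq_sym (negPf nli) scale0r /peval meval0 mul0r.
  have UU : (U_(i) - U_(i) = 0)%MM by apply/mnmP=> l; rewrite mnmBE mnm0E subnn.
  rewrite mderivX mnm1E eqxx scale1r /peval {}UU mpolyX0 meval1 mul1r.
  by case/mxvec_indexP: i => i j; rewrite !mxvecE !mxE.
- rewrite /along mmapD derivD hornerD -!/(along _ _) IH1 IH2 -big_split; apply: eq_bigr => l _.
  by rewrite mderivD /peval mevalD mulrDl.
- rewrite /along rmorphM derivM hornerD !hornerM -!/(along _ _) IH1 IH2 !along_ev.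
  rewrite mulr_suml mulr_sumr -big_split; apply: eq_bigr => l _ /=.
  by rewrite mderivM /peval mevalD !mevalM; ring.
Qed.

End Curves.

Lemma invmxM_unit (R : comUnitRingType) n (s t : 'M[R]_n) :
  s \in unitmx -> t \in unitmx -> invmx (s *m t) = invmx t *m invmx s.
Proof.
move=> sU tU; have stU : s *m t \in unitmx by rewrite unitmx_mul sU.
apply: (can_inj (mulKmx stU)); rewrite mulmxV //.
by rewrite mulmxA mulmxK // mulmxV.
Qed.

Section CurveCalculus.
Variables (k : closedFieldType) (char0 : [pchar k] =i pred0).

Lemma evM t a b c (A : 'M[{poly k}]_(a, b)) (B : 'M_(b, c)) :
  ev t (A *m B) = ev t A *m ev t B.
Proof. exact: map_mxM. Qed.

Lemma evD t a b (A B : 'M[{poly k}]_(a, b)) : ev t (A + B) = ev t A + ev t B.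
Proof. exact: map_mxD. Qed.

Lemma evZ t a b q (A : 'M[{poly k}]_(a, b)) : ev t (q *: A) = q.[t] *: ev t A.
Proof. exact: map_mxZ. Qed.

Lemma ev_adj t a (A : 'M[{poly k}]_a) : ev t (\adj A) = \adj (ev t A).
Proof. exact: map_mx_adj. Qed.

Lemma ev_det t a (A : 'M[{poly k}]_a) : (\det A).[t] = \det (ev t A).
Proof. by rewrite det_map_mx. Qed.

Lemma ev_const t a b (x : 'M[k]_(a, b)) : ev t (map_mx polyC x) = x.
Proof. by apply/matrixP=> i j; rewrite !mxE /= horner_evalE hornerC. Qed.

Lemma ev1 t a : ev t (1%:M : 'M[{poly k}]_a) = 1%:M.
Proof. exact: map_mx1. Qed.

Lemma dmxM a b c (A : 'M[{poly k}]_(a, b)) (B : 'M_(b, c)) :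
  dmx (A *m B) = dmx A *m B + A *m dmx B.
Proof.
apply/matrixP=> i j; rewrite !mxE linear_sum -big_split /=; apply: eq_bigr => l _.
by rewrite derivM !mxE.
Qed.

Lemma dmxD a b (A B : 'M[{poly k}]_(a, b)) : dmx (A + B) = dmx A + dmx B.
Proof. by apply/matrixP=> i j; rewrite !mxE derivD. Qed.

Lemma ev_sum t a b (I : finType) (F : I -> 'M[{poly k}]_(a, b)) :
  ev t (\sum_i F i) = \sum_i ev t (F i).
Proof. exact: map_mx_sum. Qed.

Lemma dmx_sum a b (I : finType) (F : I -> 'M[{poly k}]_(a, b)) :
  dmx (\sum_i F i) = \sum_i dmx (F i).
Proof.
apply: (big_morph (@dmx k a b)); first exact: dmxD.
by apply/matrixP=> i j; rewrite !mxE deriv0.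
Qed.

Lemma deriv_divided_power i :
  ((i.+1)`!%:R^-1 *: 'X^(i.+1) : {poly k})^`() = (i`!%:R^-1 : k) *: 'X^i.
Proof.
rewrite derivZ derivXn /= -scaler_nat scalerA; congr (_ *: _).
by rewrite factS natrM invfM mulrAC mulVf ?mul1r // natf_neq0_char0.
Qed.

Lemma dmx_const a b (x : 'M[k]_(a, b)) : dmx (map_mx polyC x) = 0.
Proof. by apply/matrixP=> i j; rewrite !mxE derivC. Qed.

Lemma dmx1 a : dmx (1%:M : 'M[{poly k}]_a) = 0.
Proof. by rewrite -(map_mx1 (@polyC k)) dmx_const. Qed.

Lemma dmx_scalar a (q : {poly k}) : dmx (q%:M : 'M[{poly k}]_a) = q^`()%:M.
Proof. by apply/matrixP=> i j; rewrite !mxE derivMn. Qed.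

Lemma dmxZ_const a b q (x : 'M[k]_(a, b)) :
  dmx (q *: map_mx polyC x) = q^`() *: map_mx polyC x.
Proof. by apply/matrixP=> i j; rewrite !mxE derivM derivC mulr0 addr0. Qed.

Lemma dmx_eq0 a b (A : 'M[{poly k}]_(a, b)) t : dmx A = 0 -> ev t A = ev 0 A.
Proof.
move=> dA; apply/matrixP=> i j; rewrite !mxE /= !horner_evalE.
have := congr1 (fun B : 'M_(_, _) => B i j) dA; rewrite !mxE => /(deriv_eq0_char0 char0)->.
by rewrite !hornerC.
Qed.

Lemma mx_ext_char0 a b (A B : 'M[{poly k}]_(a, b)) : (forall t, ev t A = ev t B) -> A = B.
Proof.
move=> AB; apply/matrixP=> i j; apply: (poly_ext_char0 char0) => t.
by have := congr1 (fun B : 'M_(_, _) => B i j) (AB t); rewrite !mxE.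
Qed.

Variable n : nat.
Implicit Types (S : set 'M[k]_n) (f : {mpoly k[(n * n)]}) (x y z : 'M[k]_n).

Lemma diffat_linear f x : linear (diffat f x : 'M[k]_n -> k^o).
Proof.
move=> c y z; rewrite /diffat scaler_sumr -big_split; apply: eq_bigr => i _ /=.
by rewrite linearP !mxE mulrDr mulrCA.
Qed.

HB.instance Definition _ f x :=
  GRing.isLinear.Build k 'M[k]_n k^o _ (diffat f x) (diffat_linear f x).

(* Along [C] the derivation [xi] becomes [u d/dt]; induction on the degree, for
   all [f] in the ideal of [S] at once, kills the coefficients of [f(C)]. *)
Lemma zclosure_flow S (xi : 'M[k]_n -> 'M[k]_n) (u : {poly k}) (C : 'M[{poly k}]_n) :
  regular_mx xi -> u`_0 = 1 ->
  (forall t, u.[t] *: ev t (dmx C) = xi (ev t C)) -> S (ev 0 C) ->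
  (forall f, vanishes_on f S -> forall x, S x -> diffat f x (xi x) = 0) ->
  forall t, zclosure S (ev t C).
Proof.
move=> rxi u0 uC SC0 xiS.
have along0 d f : vanishes_on f S -> forall j, (j <= d)%N -> (along f C)`_j = 0.
  elim: d f => [|d IHd] f fS j.
    by rewrite leqn0 => /eqP->; rewrite -horner_coef0 along_ev fS.
  rewrite leq_eqVlt ltnS => /orP[/eqP->{j}|]; last exact: IHd.
  have [g gE] : regular (fun x => diffat f x (xi x)).
    apply: regular_sum => l; apply: regularM; first exact: regular_peval.
    by case/mxvec_indexP: l => a b; apply: regular_ext (rxi a b) => x; rewrite mxvecE.
  have ug : u * (along f C)^`() = along g C.
    apply: (poly_ext_char0 char0) => t; rewrite hornerM deriv_along along_ev gE -uC.
    by rewrite linearZ.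
  have := congr1 (fun q : {poly k} => q`_d) ug; rewrite (IHd g) //; last first.
    by move=> x Sx; rewrite gE; apply: xiS.
  rewrite coefM big_ord_recl big1 => [|i _] /=; last first.
    by rewrite coef_deriv (IHd f) ?mul0rn ?mulr0 // -subSn ?ltn_ord //= /bump /= subSS leq_subr.
  rewrite addr0 subn0 u0 mul1r coef_deriv => /eqP.
  by rewrite -mulr_natl mulf_eq0 (negPf (natf_neq0_char0 char0 d)) => /eqP.
move=> t f fS; rewrite -along_ev.
rewrite (_ : along f C = 0) ?horner0 //.
by apply/polyP=> j; rewrite coef0 (along0 j f fS j).
Qed.

(** A curve with the first-order behaviour that [diff1] sees; it may leave a group whose Lie algebra
    contains [z]. *)
Definition line z : 'M[{poly k}]_n := 1%:M + 'X *: map_mx polyC z.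

Lemma ev_line z t : ev t (line z) = 1%:M + t *: z.
Proof. by rewrite evD ev1 evZ hornerX ev_const. Qed.

Lemma dmx_line z : dmx (line z) = map_mx polyC z.
Proof. by rewrite dmxD dmx1 add0r dmxZ_const derivX scale1r. Qed.

Lemma diff1_along f z (C : 'M[{poly k}]_n) : ev 0 C = 1%:M -> ev 0 (dmx C) = z ->
  diff1 f z = (along f C)^`().[0].
Proof. by move=> C0 C0'; rewrite deriv_along C0 C0'. Qed.

Lemma diff1_line f z : diff1 f z = (along f (line z))^`().[0].
Proof.
by apply: diff1_along; rewrite ?ev_line ?scale0r ?addr0 // dmx_line ev_const.
Qed.

Lemma diffat_affine (P : {linear 'M[k]_n -> 'M[k]_n}) i j c f :
  (forall x, peval f x = P x i j - c) -> forall x z, diffat f x z = P z i j.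
Proof.
move=> fE x X; pose C := map_mx polyC x + 'X *: map_mx polyC X.
have C0 : ev 0 C = x by rewrite evD ev_const evZ hornerX scale0r addr0.
have C0' : ev 0 (dmx C) = X.
  by rewrite dmxD dmx_const add0r dmxZ_const derivX scale1r ev_const.
rewrite -[in LHS]C0 -[in LHS]C0' -deriv_along.
rewrite (_ : along f C = (P x i j - c)%:P + (P X i j)%:P * 'X).
  by rewrite derivD derivC add0r derivM derivC derivX mul0r add0r mulr1 hornerC.
apply: (poly_ext_char0 char0) => t; rewrite along_ev fE hornerD hornerM hornerX !hornerC.
by rewrite evD ev_const evZ ev_const hornerX linearD linearZ !mxE [t * _]mulrC addrAC.
Qed.

(** Turns membership in a subspace into the vanishing of a linear map, whose entries are regular
    functions. *)
Lemma vspace_kernel (U : {vspace 'M[k]_n}) :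
  exists P : {linear 'M[k]_n -> 'M[k]_n}, forall x, P x = 0 <-> x \in U.
Proof.
have linP : linear (fun x => x - projv U x).
  by move=> c u v; rewrite linearP scalerBr opprD addrACA.
pose P : {linear 'M[k]_n -> 'M[k]_n} :=
  HB.pack (fun x => x - projv U x) (GRing.isLinear.Build _ _ _ _ _ linP).
exists P => x; split=> /= [/eqP|xU].
  by rewrite subr_eq0 => /eqP->; apply: memv_proj.
by rewrite projv_id // subrr.
Qed.

(** * Differentiating the adjoint action *)

Section Tangent.
Variable G : set 'M[k]_n.
Hypothesis detG : forall g, G g -> \det g = 1.

(** On matrices of determinant one this makes inversion, hence conjugation, a regular map. *)
Lemma invmx_det1 (g : 'M[k]_n) : \det g = 1 -> invmx g = \adj g.
Proof. by move=> dg; rewrite /invmx unitmxE dg unitr1 invr1 scale1r. Qed.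

(** The function sending [s] to [f (s y \adj s)] vanishes on [G], so its differential at the
    identity kills [z]. Since [\adj] has derivative [- z] there, this value is the differential of
    [f] at [y] in the direction [[z, y]]. *)
Lemma diffat_adjoint f y z : (forall g, G g -> peval f (g *m y *m invmx g) = 0) ->
  z \in lie G -> diffat f y (bracket z y) = 0.
Proof.
move=> fG /lieP zG.
have [f1 f1E] : regular (fun g => peval f (g *m y *m \adj g)).
  apply: (regular_comp (regular_peval f)); apply: regular_mxM.
    by apply: regular_mxM (@regular_mx_const _ _ _ _ y); apply: regular_mx_id.
  exact/regular_mx_adj/regular_mx_id.
have [f2 f2E] : regular (fun g : 'M[k]_n => \det g - 1).
  by apply: regularB (regular_const _ 1); apply: regular_det (@regular_mx_id _ _).
have zf1 : diff1 f1 z = 0.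
  by apply: zG => g Gg; rewrite f1E -invmx_det1 ?fG ?detG.
have zf2 : diff1 f2 z = 0 by apply: zG => g Gg; rewrite f2E detG // subrr.
have det' : (\det (line z))^`().[0] = 0.
  rewrite -[RHS]zf2 diff1_line; suff -> : along f2 (line z) = \det (line z) - 1%:P.
    by rewrite derivB derivC subr0.
  apply: (poly_ext_char0 char0) => t.
  by rewrite along_ev f2E hornerD hornerN hornerC ev_det.
pose D := line z *m map_mx polyC y *m \adj (line z).
have alongD : along f1 (line z) = along f D.
  by apply: (poly_ext_char0 char0) => t; rewrite !along_ev f1E !evM ev_const ev_adj.
have ev0 : ev 0 (line z) = 1%:M by rewrite ev_line scale0r addr0.
(* Differentiate [line z *m \adj (line z) = (\det (line z))%:M] at 0, where the determinant has
   derivative 0. *)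
have adj' : ev 0 (dmx (\adj (line z))) = - z.
  have := congr1 (fun A => ev 0 (dmx A)) (mul_mx_adj (line z)).
  rewrite dmxM evD !evM dmx_line ev_const ev_adj ev0 adj1 mulmx1 mul1mx dmx_scalar.
  have -> : ev 0 ((\det (line z))^`()%:M : 'M_n) = 0.
    by apply/matrixP=> i j; rewrite !mxE /= horner_evalE hornerMn det' mul0rn.
  by move/eqP; rewrite addrC addr_eq0 => /eqP.
have := zf1; rewrite diff1_line alongD deriv_along /D => D0; rewrite -[RHS]D0 {D0}.
rewrite !evM ev_const ev_adj ev0 adj1 mul1mx mulmx1; congr (diffat _ _ _).
rewrite !dmxM dmx_line dmx_const mulmx0 addr0 evD !evM adj' !ev_const ev_adj ev0 adj1.
by rewrite mulmx1 mul1mx mulmxN.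
Qed.

(** Subtracting the constant [c] makes the entries of [P] vanish on the orbit without changing their
    differentials. *)
Lemma linear_adjoint (P : {linear 'M[k]_n -> 'M[k]_n}) y z c :
  (forall g, G g -> P (g *m y *m invmx g) = c) -> z \in lie G -> P (bracket z y) = 0.
Proof.
move=> PG zG; apply/matrixP=> i j; rewrite [RHS]mxE.
have [f fE] : regular (fun x => P x i j - c i j).
  by apply: regularB (regular_const _ _); apply: regular_linear.
by rewrite -(diffat_affine fE y) diffat_adjoint // => g Gg; rewrite fE PG // subrr.
Qed.

Lemma lie_stable g x : subgroup_GL G -> G g -> x \in lie G -> g *m x *m invmx g \in lie G.
Proof.
move=> [GU _ GM GV] Gg /lieP xG; apply/lieP => f fG.
have [f1 f1E] : regular (fun y => peval f (g *m y *m invmx g)).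
  apply: (regular_comp (regular_peval f)); apply: regular_mxM (@regular_mx_const _ _ _ _ _).
  by apply: regular_mxM (@regular_mx_id _ _); apply: regular_mx_const.
rewrite -[RHS](xG f1) => [|y Gy]; last first.
  by rewrite f1E fG //; apply: (GM _ _ (GM _ _ _ _)) => //; apply: GV.
rewrite diff1_line [RHS]diff1_line; congr (_^`().[0]); apply: (poly_ext_char0 char0) => t.
rewrite !along_ev f1E !ev_line; congr (peval f _).
by rewrite mulmxDr mulmxDl mulmx1 mulmxV ?GU // -scalemxAr -scalemxAl.
Qed.

Definition stable_under (U : {vspace 'M[k]_n}) :=
  forall g x, G g -> x \in U -> g *m x *m invmx g \in U.

Lemma bracket_stable U y z : stable_under U -> z \in lie G -> y \in U -> bracket z y \in U.
Proof.
move=> sU zG yU.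
have [P PE] := vspace_kernel U.
apply/PE/(@linear_adjoint P y z 0) => // g Gg.
by apply/PE/sU.
Qed.

End Tangent.
End CurveCalculus.

(** * Exponentials of nilpotent matrices *)

Section Exponential.
Variables (k : closedFieldType) (char0 : [pchar k] =i pred0) (n : nat).
Implicit Types (a b x y z g : 'M[k]_n) (m : nat).

Lemma exprZ_mx c a i : (c *: a) ^+ i = c ^+ i *: a ^+ i.
Proof.
elim: i => [|i IHi]; first by rewrite !expr0 scale1r.
by rewrite !exprS IHi -!mulmxE -scalemxAl -scalemxAr scalerA.
Qed.

Lemma conj_expr g a i : g \in unitmx -> (g *m a *m invmx g) ^+ i = g *m a ^+ i *m invmx g.
Proof.
move=> gU; elim: i => [|i IHi]; first by rewrite !expr0 mulmx1 mulmxV.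
by rewrite !exprS IHi -!mulmxE -!mulmxA mulKmx // .
Qed.

(* The exponential series truncated after degree [m]: the exponential only when
   [a ^+ m.+1 = 0]. *)
Definition expmx m a : 'M[k]_n := \sum_(i < m.+1) (i`!%:R)^-1 *: a ^+ i.

Definition expcurve m a : 'M[{poly k}]_n :=
  \sum_(i < m.+1) ((i`!%:R)^-1 *: 'X^i) *: map_mx polyC (a ^+ i).

Lemma ev_expcurve m a t : ev t (expcurve m a) = expmx m (t *: a).
Proof.
rewrite /expcurve /expmx /ev map_mx_sum; apply: eq_bigr => i _.
by rewrite [LHS]evZ ev_const hornerZ hornerXn exprZ_mx scalerA.
Qed.

Lemma expmx0 m : expmx m 0 = 1%:M.
Proof.
rewrite /expmx big_ord_recl big1 => [|i _]; last first.
  by rewrite exprS mul0r scaler0.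
by rewrite fact0 invr1 scale1r expr0 addr0.
Qed.

Lemma ev0_expcurve m a : ev 0 (expcurve m a) = 1%:M.
Proof. by rewrite ev_expcurve scale0r expmx0. Qed.

Lemma dmx_expcurve m a : a ^+ m.+1 = 0 -> dmx (expcurve m a) = expcurve m a *m map_mx polyC a.
Proof.
move=> am0; rewrite /expcurve mulmx_suml.
rewrite dmx_sum big_ord_recl dmxZ_const /= expr0 derivZ derivC scaler0 scale0r add0r.
have powS i : a ^+ i *m a = a ^+ i.+1 by rewrite exprSr.
rewrite [RHS]big_ord_recr /= -scalemxAl -map_mxM powS am0 map_mx0 scaler0 addr0.
apply: eq_bigr => i _; rewrite dmxZ_const -scalemxAl -map_mxM powS; congr (_ *: _).
exact: deriv_divided_power.
Qed.

Lemma comm_expcurve m a : expcurve m a *m map_mx polyC a = map_mx polyC a *m expcurve m a.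
Proof.
rewrite /expcurve mulmx_suml mulmx_sumr; apply: eq_bigr => i _.
rewrite -scalemxAl -scalemxAr -!map_mxM; congr (_ *: map_mx _ _).
exact: (etrans (esym (exprSr _ _)) (exprS _ _)).
Qed.

(** The product of [exp (t a)] and [exp (- t a)] has derivative 0 in [t], so it keeps its value at
    [t = 0]. *)
Lemma expmxN m a : a ^+ m.+1 = 0 -> expmx m a *m expmx m (- a) = 1%:M.
Proof.
move=> am0; pose K := expcurve m a *m expcurve m (- a).
have Nam0 : (- a) ^+ m.+1 = 0 by rewrite -scaleN1r exprZ_mx am0 scaler0.
have : dmx K = 0.
  by rewrite dmxM !dmx_expcurve // (comm_expcurve m (- a)) map_mxN mulNmx mulmxN mulmxA subrr.
move/(dmx_eq0 char0 1).
by rewrite !evM !ev0_expcurve mulmx1 !ev_expcurve !scale1r.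
Qed.

Lemma expmx_unit m a : a ^+ m.+1 = 0 -> expmx m a \in unitmx.
Proof. by move/expmxN/mulmx1_unit => []. Qed.

Lemma invmx_expmx m a : a ^+ m.+1 = 0 -> invmx (expmx m a) = expmx m (- a).
Proof.
by move=> am0; rewrite -[LHS]mulmx1 -(expmxN am0) mulKmx // expmx_unit.
Qed.

(** [\det (exp (t a))] is a polynomial in [t] with a polynomial inverse, hence constant, equal to
    its value at [t = 0]. *)
Lemma det_expmx m a : a ^+ m.+1 = 0 -> \det (expmx m a) = 1.
Proof.
move=> am0; have inv1 : \det (expcurve m a) * \det (expcurve m (- a)) = 1.
  apply: (poly_ext_char0 char0) => t.
  rewrite hornerM !ev_det !ev_expcurve hornerC scalerN -det_mulmx expmxN ?det1 //.
  by rewrite exprZ_mx am0 scaler0.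
have : size (\det (expcurve m a) * \det (expcurve m (- a))) == 1 by rewrite inv1 size_poly1.
rewrite size_mul_eq1 => /andP[/eqP sz1 _].
have /size1_polyC detC : (size (\det (expcurve m a)) <= 1)%N by rewrite sz1.
have := congr1 (horner^~ 1) detC; rewrite ev_det ev_expcurve scale1r hornerC => ->.
by rewrite -horner_coef0 ev_det ev0_expcurve det1.
Qed.

Lemma expmx_conj m g a : g \in unitmx ->
  expmx m (g *m a *m invmx g) = g *m expmx m a *m invmx g.
Proof.
move=> gU; rewrite /expmx mulmx_sumr mulmx_suml; apply: eq_bigr => i _.
by rewrite conj_expr // -scalemxAr -scalemxAl.
Qed.

(** The field [x *m a] is tangent to [G] at each of its points by left translation, and [exp (t a)]
    is its integral curve through the identity. *)
Lemma expmx_in_group (G : set 'M[k]_n) m a : algebraic_group G ->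
  a \in lie G -> a ^+ m.+1 = 0 -> G (expmx m a).
Proof.
move=> [[GU G1 GM GV] Gcl] /lieP aG am0; apply: Gcl; split; last exact: expmx_unit.
rewrite -[a]scale1r -ev_expcurve.
apply: (@zclosure_flow k char0 n G (fun x => x *m a) 1) => //.
- by apply: regular_mxM; [apply: regular_mx_id|apply: regular_mx_const].
- by rewrite coef1.
- by move=> t; rewrite hornerC scale1r dmx_expcurve // evM ev_const.
- by rewrite ev0_expcurve.
move=> f fG x Gx.
have [g gE] : regular (fun y => peval f (x *m y)).
  apply: (regular_comp (regular_peval f)).
  by apply: regular_mxM; [apply: regular_mx_const|apply: regular_mx_id].
have g0 : diff1 g a = 0 by apply: aG => y Gy; rewrite gE fG //; apply: GM.
rewrite -[RHS]g0 diff1_line (_ : along g _ = along f (map_mx polyC x *m line a)).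
  rewrite deriv_along evM ev_const ev_line scale0r addr0 mulmx1 dmxM dmx_const mul0mx add0r.
  by rewrite dmx_line evM !ev_const.
by apply: (poly_ext_char0 char0) => t; rewrite !along_ev gE evM ev_const.
Qed.

End Exponential.

(** * Groups generated by exponentials *)

Section Simplicity.
Variables (k : closedFieldType) (char0 : [pchar k] =i pred0) (n : nat).
Implicit Types (a b x y z g s : 'M[k]_n) (m : nat) (X G : set 'M[k]_n).

(** Generation uses products only; once [X] is closed under scaling, inverses come from
    [exp (- b)]. *)
Inductive expgen m X : set 'M[k]_n :=
| expgen1 : expgen m X 1%:M
| expgenM s b : expgen m X s -> X b -> expgen m X (s *m expmx m b).

Lemma expgen_exp m X b : X b -> expgen m X (expmx m b).
Proof. by move=> Xb; rewrite -[expmx m b]mul1mx; apply: expgenM => //; constructor. Qed.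

Lemma expgen_mul m X s1 s2 : expgen m X s1 -> expgen m X s2 -> expgen m X (s1 *m s2).
Proof.
move=> s1X; elim=> [|s b _ IH Xb]; first by rewrite mulmx1.
by rewrite mulmxA; apply: expgenM.
Qed.

Section Generators.
Variables (m : nat) (X : set 'M[k]_n).
Hypotheses (Xnil : forall b, X b -> b ^+ m.+1 = 0) (XZ : forall c b, X b -> X (c *: b)).

Lemma expgen_det s : expgen m X s -> \det s = 1.
Proof.
elim=> [|t b _ IH Xb]; first exact: det1.
by rewrite det_mulmx IH mul1r det_expmx ?Xnil.
Qed.

Lemma expgen_unit s : expgen m X s -> s \in unitmx.
Proof. by move=> /expgen_det ds; rewrite unitmxE ds unitr1. Qed.

Lemma expgen_inv s : expgen m X s -> expgen m X (invmx s).
Proof.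
elim=> [|t b tX IH Xb]; first by rewrite invmx1; constructor.
rewrite invmxM_unit ?(expmx_unit char0) ?(invmx_expmx char0) ?Xnil ?expgen_unit //.
by apply: expgen_mul => //; apply: expgen_exp; rewrite -scaleN1r; apply: XZ.
Qed.

Lemma zclosure_expgen_det s : zclosure (expgen m X) s -> \det s = 1.
Proof.
move=> Ns; apply/eqP; rewrite -subr_eq0; apply/eqP.
have r : regular (fun s : 'M[k]_n => \det s - 1).
  by apply: regularB (regular_const _ 1); apply: regular_det (@regular_mx_id _ _).
by apply: (zclosure_regular Ns r) => t /expgen_det->; rewrite subrr.
Qed.

(** Stability under products is extended to the closure one factor at a time. All determinants are
    1, so inversion is the regular map [\adj], and elements of the closure stay invertible. *)
Lemma zclosure_expgen_alg : algebraic_group (zclosure (expgen m X)).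
Proof.
split; last by move=> s [Ns _]; exact: (zclosureS (fun x Nx => Nx) Ns).
have inC := @sub_zclosure k n (expgen m X); split.
- by move=> s /zclosure_expgen_det ds; rewrite unitmxE ds unitr1.
- by apply: inC; constructor.
- have mulr_cl s t : expgen m X s -> zclosure (expgen m X) t -> zclosure (expgen m X) (s *m t).
    move=> Ns Nt f fN; apply: (zclosure_regular Nt (F := fun y => peval f (s *m y))).
      apply: (regular_comp (regular_peval f)).
      by apply: regular_mxM; [apply: regular_mx_const|apply: regular_mx_id].
    by move=> y Ny; apply: fN; apply: expgen_mul.
  move=> s t Ns Nt f fN; apply: (zclosure_regular Ns (F := fun y => peval f (y *m t))).
    apply: (regular_comp (regular_peval f)).
    by apply: regular_mxM; [apply: regular_mx_id|apply: regular_mx_const].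
  by move=> y Ny; apply: (mulr_cl y t).
move=> s Ns; rewrite (invmx_det1 (zclosure_expgen_det Ns)) => f fN.
apply: (zclosure_regular Ns (F := fun y => peval f (\adj y))).
  exact: (regular_comp (regular_peval f) (regular_mx_adj (@regular_mx_id _ _))).
move=> y Ny; rewrite -(invmx_det1 (expgen_det Ny)); exact/fN/expgen_inv.
Qed.

(* A curve [t |-> s * exp (t b)] lies in one of two closed sets covering it,
   because [k] is infinite. *)
Lemma zclosure_expgen_connected : zconnected (zclosure (expgen m X)).
Proof.
move=> A B Acl Bcl covAB AB0.
wlog A1 : A B Acl Bcl covAB AB0 / A 1%:M.
  move=> W; have [|A1|B1] := covAB 1%:M; first by apply: sub_zclosure; constructor.
    exact: (W A B).
  case: (W B A Bcl Acl) => //; rewrite ?[B `|` A]setUC ?[B `&` A]setIC //; by [right|left].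
left; suff NA : expgen m X `<=` A by move=> s Ns; apply: Acl => f fA; apply: Ns => y /NA; apply: fA.
move=> s; elim=> // {}s b Ns As Xb.
apply: Acl => f fA.
have Nst t : zclosure (expgen m X) (s *m expmx m (t *: b)).
  by apply/sub_zclosure/expgenM => //; apply: XZ.
have [f' fB' nz_f'] : exists2 f', vanishes_on f' B & peval f' s != 0.
  apply: contrapT => nf'; have : (set0 : set 'M[k]_n) s; last by [].
  rewrite -AB0; split; first exact/sub_zclosure.
  split=> //; apply: Bcl => f' fB'; apply/eqP/negPn/negP => nz; apply: nf'; by exists f'.
pose C := map_mx polyC s *m expcurve m b.
have Ct t : ev t C = s *m expmx m (t *: b) by rewrite evM ev_const ev_expcurve.
have : along f C * along f' C = 0.
  apply: (poly_eq0_char0 char0) => t; rewrite hornerM !along_ev Ct.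
  by case: (covAB _ (Nst t)) => [/fA->|/fB'->]; rewrite ?mul0r ?mulr0.
move/eqP; rewrite mulf_eq0 => /orP[/eqP fC0|/eqP fC0].
  by rewrite -[b]scale1r -Ct -along_ev fC0 horner0.
case/negP: nz_f'; have := congr1 (horner^~ 0) fC0.
by rewrite along_ev Ct scale0r expmx0 mulmx1 horner0 => ->.
Qed.

(** If every [exp (t b)] is the identity, differentiating in [t] gives [b = 0]. *)
Lemma zclosure_expgen_eq1 b : X b -> zclosure (expgen m X) = [set 1%:M] -> b = 0.
Proof.
move=> Xb N1; have exp1 t : expmx m (t *: b) = 1%:M.
  suff : zclosure (expgen m X) (expmx m (t *: b)) by rewrite N1.
  by apply/sub_zclosure/expgen_exp/XZ.
have E1 : expcurve m b = 1%:M.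
  by apply: (mx_ext_char0 char0) => t; rewrite ev_expcurve exp1 ev1.
have := dmx_expcurve char0 (Xnil Xb); rewrite E1 mul1mx dmx1 => /(congr1 (fun A => ev 0 A)).
by rewrite ev_const => <-; apply/matrixP=> i j; rewrite !mxE /= horner_evalE horner0.
Qed.

(** The closure is a connected normal algebraic subgroup of [G], and it is not trivial because [b]
    is nonzero. *)
Lemma simple_expgen G b : simple_algebraic_group G -> X `<=` [set x | x \in lie G] ->
  (forall g x, G g -> X x -> X (g *m x *m invmx g)) -> X b -> b != 0 ->
  G = zclosure (expgen m X).
Proof.
move=> [Galg _ _ simpleG] XG XJ Xb nz_b.
have [[GU G1 GM GV] Gcl] := Galg.
have NG : expgen m X `<=` G.
  move=> s; elim=> // t c _ Gt Xc; apply: GM => //.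
  by apply: expmx_in_group => //; [apply: XG|apply: Xnil].
have clNG : zclosure (expgen m X) `<=` G.
  move=> s Ns; apply: Gcl; split; last by rewrite /= unitmxE (zclosure_expgen_det Ns) unitr1.
  by apply: zclosureS Ns => y /NG; apply: sub_zclosure.
case: (simpleG _ zclosure_expgen_alg zclosure_expgen_connected) => //.
  split=> // g s Gg Ns f fN.
  apply: (zclosure_regular Ns (F := fun y => peval f (g *m y *m invmx g))).
    apply: (regular_comp (regular_peval f)); apply: regular_mxM (@regular_mx_const _ _ _ _ _).
    by apply: regular_mxM (@regular_mx_id _ _); apply: regular_mx_const.
  move=> y Ny; apply: fN; elim: Ny => [|t c Nt IH Xc].
    by rewrite mulmx1 mulmxV ?GU //; constructor.
  have -> : g *m (t *m expmx m c) *m invmx g =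
      (g *m t *m invmx g) *m expmx m (g *m c *m invmx g).
    by rewrite expmx_conj ?GU // !mulmxA mulmxKV ?GU.
  by apply: expgenM => //; apply: XJ.
by move/(zclosure_expgen_eq1 Xb) => b0; rewrite b0 eqxx in nz_b.
Qed.

End Generators.
End Simplicity.

(** * Nilpotent elements in the Lie algebra of a simple group *)

Section SimpleGroup.
Variables (k : closedFieldType) (char0 : [pchar k] =i pred0) (n : nat) (G : set 'M[k]_n).
Hypothesis simpleG : simple_algebraic_group G.
Implicit Types (x y z : 'M[k]_n) (U : {vspace 'M[k]_n}).

Let Galg : algebraic_group G. Proof. by case: simpleG. Qed.
Let Gsub : subgroup_GL G. Proof. by case: Galg. Qed.

Lemma group_unit g : G g -> g \in unitmx. Proof. by case: Gsub => GU _ _ _ /GU. Qed.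
Lemma group_mul g1 g2 : G g1 -> G g2 -> G (g1 *m g2). Proof. by case: Gsub => _ _ + _; apply. Qed.

(** Scalars are included so that each conjugate of [x] brings its whole one-parameter group. *)
Definition cone_orbit x : set 'M[k]_n :=
  [set b | exists c g, G g /\ b = c *: (g *m x *m invmx g)].

Section NilpotentElement.
Variables (x : 'M[k]_n) (m : nat).
Hypotheses (xG : x \in lie G) (nz_x : x != 0) (xm : x ^+ m.+1 = 0).

Lemma cone_orbit_self : cone_orbit x x.
Proof. by exists 1, 1%:M; split; [case: Gsub|rewrite scale1r mul1mx invmx1 mulmx1]. Qed.

Lemma cone_orbit_nilp b : cone_orbit x b -> b ^+ m.+1 = 0.
Proof.
case=> c [g [Gg ->]].
by rewrite exprZ_mx conj_expr ?group_unit // xm mulmx0 mul0mx scaler0.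
Qed.

Lemma cone_orbitZ c b : cone_orbit x b -> cone_orbit x (c *: b).
Proof. by case=> c' [g [Gg ->]]; exists (c * c'), g; rewrite scalerA. Qed.

Lemma cone_orbit_stable U : stable_under G U -> x \in U -> cone_orbit x `<=` [set b | b \in U].
Proof. by move=> sU xU b [c [g [Gg ->]]] /=; apply/memvZ/sU. Qed.

Lemma simple_expgen_orbit : G = zclosure (expgen m (cone_orbit x)).
Proof.
apply: (simple_expgen char0 cone_orbit_nilp cone_orbitZ simpleG _ _ cone_orbit_self nz_x).
  by apply: cone_orbit_stable => // g y Gg; apply: lie_stable.
move=> g b Gg [c [g' [Gg' ->]]]; exists c, (g *m g'); split; first exact: group_mul.
rewrite -scalemxAr -scalemxAl; congr (_ *: _).
by rewrite invmxM_unit ?group_unit // !mulmxA.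
Qed.

(** Exponentials of nilpotent matrices have determinant one, which is a closed condition. *)
Lemma simple_det1 g : G g -> \det g = 1.
Proof. by rewrite simple_expgen_orbit => /(zclosure_expgen_det char0 cone_orbit_nilp). Qed.

(** Let [b] be a multiple of a conjugate of [x]. The derivative of [exp (t b) y exp (- t b)] is the
    conjugate of [[b, y]] by [exp (t b)], which lies in [U], so modulo [U] these exponentials fix
    [y]. They generate a dense subgroup of [G], so [G] fixes [y] modulo [U], and differentiating
    puts [[z, y]] in [U]. *)
Lemma simple_bracket U y z : stable_under G U -> x \in U ->
  y \in lie G -> z \in lie G -> bracket z y \in U.
Proof.
move=> sU xU yG zG; have [P PE] := vspace_kernel U.
have PJ g u : G g -> u \in U -> P (g *m u *m invmx g) = 0 by move=> Gg uU; apply/PE/sU.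
have expP b : cone_orbit x b -> P (expmx m b *m y *m expmx m (- b)) = P y.
  move=> Xb; have bm := cone_orbit_nilp Xb.
  have Gexp t : G (expmx m (t *: b)).
    have Xtb := cone_orbitZ t Xb.
    rewrite simple_expgen_orbit; apply/sub_zclosure/expgen_exp/Xtb.
  have byU : bracket b y \in U.
    have := bracket_stable char0 simple_det1 sU yG (cone_orbit_stable sU xU Xb).
    by rewrite -memvN /bracket opprB.
  pose C := expcurve m b *m map_mx polyC y *m expcurve m (- b).
  have Nbm : (- b) ^+ m.+1 = 0 by rewrite -scaleN1r exprZ_mx bm scaler0.
  have dC : dmx C = expcurve m b *m map_mx polyC (bracket b y) *m expcurve m (- b).
    rewrite /C !dmxM !(dmx_expcurve char0) // dmx_const mulmx0 addr0.
    rewrite (comm_expcurve m (- b)) map_mxN mulNmx mulmxN /bracket map_mxB !map_mxM.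
    by rewrite mulmxBr mulmxBl !mulmxA.
  apply/matrixP=> i j; have [f fE] := regular_linear P i j.
  have fE0 u : peval f u = P u i j - 0 by rewrite fE subr0.
  have fC0 : (along f C)^`() = 0.
    apply: (poly_eq0_char0 char0) => t; rewrite deriv_along (diffat_affine char0 fE0).
    rewrite dC !evM ev_const !ev_expcurve scalerN -invmx_expmx //; last first.
      by rewrite exprZ_mx bm scaler0.
    by rewrite PJ // mxE.
  have := deriv_eq0_char0 char0 fC0.
  move=> fC; have := congr1 (horner^~ 1) fC; have := congr1 (horner^~ 0) fC.
  rewrite !hornerC => <-; rewrite !along_ev !fE !evM !ev_const !ev_expcurve.
  by rewrite !scale0r !scale1r !expmx0 mul1mx mulmx1.
(* With [\adj] for the inverse the condition is polynomial in [g], so it passes from the generated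
   group to its closure [G]. *)
have PG g : G g -> P (g *m y *m \adj g) - P y = 0.
  rewrite {1}simple_expgen_orbit => Ng.
  apply: (zclosure_regular_mx Ng (T := fun g => P (g *m y *m \adj g) - P y)).
    apply: regular_mxB (@regular_mx_const _ _ _ _ _) => i j.
    apply: (@regular_comp _ _ (fun u => P u i j) (fun g => g *m y *m \adj g)).
      exact: regular_linear.
    apply: regular_mxM; last exact/regular_mx_adj/regular_mx_id.
    by apply: regular_mxM (@regular_mx_const _ _ _ _ _); apply: regular_mx_id.
  move=> s Ns; have dets := expgen_det char0 cone_orbit_nilp.
  rewrite -invmx_det1 ?dets //; apply/eqP; rewrite subr_eq0; apply/eqP.
  elim: Ns => [|t b Nt IH Xb]; first by rewrite invmx1 mul1mx mulmx1.
  have Gt : G t by rewrite simple_expgen_orbit; apply: sub_zclosure.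
  have bm := cone_orbit_nilp Xb.
  rewrite invmxM_unit ?(expmx_unit char0) ?(invmx_expmx char0) ?group_unit //.
  have -> : t *m expmx m b *m y *m (expmx m (- b) *m invmx t) =
     t *m y *m invmx t + t *m (expmx m b *m y *m expmx m (- b) - y) *m invmx t.
    by rewrite mulmxBr mulmxBl !mulmxA addrC subrK.
  rewrite linearD IH [X in _ + X]PJ ?addr0 //.
  by apply/PE; rewrite linearB expP // subrr.
apply/PE/(linear_adjoint char0 simple_det1 (c := P y)) => // g Gg.
by apply/eqP; rewrite -subr_eq0 invmx_det1 ?simple_det1 // PG.
Qed.

End NilpotentElement.
End SimpleGroup.

(** * Brackets and powers of adjoint operators *)

Section Bracket.
Variables (k : closedFieldType) (char0 : [pchar k] =i pred0) (n : nat).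
Implicit Types (a x y z : 'M[k]_n) (V : {vspace 'M[k]_n}).

Lemma bracketC x y : bracket x y = - bracket y x.
Proof. by rewrite /bracket opprB. Qed.

Lemma bracketDr x y z : bracket x (y + z) = bracket x y + bracket x z.
Proof. by have := bracket_linearr 1 x y z; rewrite !scale1r. Qed.

Lemma bracket0r x : bracket x 0 = 0.
Proof. by rewrite /bracket mulmx0 mul0mx subrr. Qed.

Lemma bracketZr c x y : bracket x (c *: y) = c *: bracket x y.
Proof. by have := bracket_linearr c x y 0; rewrite bracket0r !addr0. Qed.

Lemma bracketNr x y : bracket x (- y) = - bracket x y.
Proof. by rewrite -scaleN1r bracketZr scaleN1r. Qed.

Lemma bracketMnr x y i : bracket x (y *+ i) = bracket x y *+ i.
Proof. by rewrite -scaler_nat bracketZr scaler_nat. Qed.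

Lemma bracket_jacobi x y z :
  bracket (bracket x y) z = bracket x (bracket y z) - bracket y (bracket x z).
Proof.
rewrite /bracket !(mulmxBl, mulmxBr) !mulmxA.
set A := x *m y *m z; set B := y *m x *m z; set C := z *m x *m y; set D := z *m y *m x.
set E := x *m z *m y; set F := y *m z *m x.
by apply/matrixP=> i j; rewrite !mxE; ring.
Qed.

Lemma bracket_conj g x y : g \in unitmx ->
  bracket (g *m x *m invmx g) (g *m y *m invmx g) = g *m bracket x y *m invmx g.
Proof. by move=> gU; rewrite /bracket mulmxBr mulmxBl !mulmxA !mulmxKV. Qed.

Definition adpow x i := iter i (bracket x).

Lemma adpow_linear x i c y z : adpow x i (c *: y + z) = c *: adpow x i y + adpow x i z.
Proof. by elim: i => //= i ->; rewrite bracket_linearr. Qed.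

Lemma adpow0r x i : adpow x i 0 = 0.
Proof. by elim: i => //= i ->; rewrite bracket0r. Qed.

Lemma adpowD x i y z : adpow x i (y + z) = adpow x i y + adpow x i z.
Proof. by have := adpow_linear x i 1 y z; rewrite !scale1r. Qed.

Lemma adpow_mem V x i y : (forall y, y \in V -> bracket x y \in V) ->
  y \in V -> adpow x i y \in V.
Proof. by move=> xV yV; elim: i => //= i; apply: xV. Qed.

Lemma adpow_conj g x i y : g \in unitmx ->
  adpow (g *m x *m invmx g) i (g *m y *m invmx g) = g *m adpow x i y *m invmx g.
Proof. by move=> gU; elim: i => //= i ->; rewrite bracket_conj. Qed.

(** Every term of the expansion is a multiple of [a ^+ i * y * a ^+ j] with [i + j = m + m], so one
    exponent reaches [m]. The induction carries such outer factors along. *)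
Lemma adpow_nilpotent a m y : a ^+ m = 0 -> adpow a (m + m) y = 0.
Proof.
move=> am0; suff adm N i j : (m + m <= N + i + j)%N -> a ^+ i * adpow a N y * a ^+ j = 0.
  by have := adm (m + m)%N 0%N 0%N; rewrite !addn0 leqnn mul1r mulr1; apply.
elim: N i j => [|N IHN] i j /= ij.
  have [im|im] := leqP m i; first by rewrite -(subnK im) exprD am0 mulr0 !mul0r.
  have jm : (m <= j)%N by lia.
  by rewrite -(subnK jm) addnC exprD am0 mul0r mulr0.
rewrite /bracket mulrBr mulrBl !mulmxE !mulrA -exprSr.
by rewrite -[_ * a * a ^+ j]mulrA -exprS !IHN ?subr0 //; lia.
Qed.

Lemma bracket_weight2 a h y : bracket h a = a *+ 2 ->
  bracket h (bracket a y) = bracket a (bracket h y) + bracket a y *+ 2.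
Proof.
move=> ha; have := bracket_jacobi h a y; rewrite ha => /eqP.
rewrite -scaler_nat -[_ *: a]addr0 bracket_linearl /(bracket 0) mul0mx mulmx0 subrr addr0.
by rewrite scaler_nat eq_sym subr_eq => /eqP->; rewrite addrC.
Qed.

(* The identity [a^M, z] = M a^(M-1) (h + M - 1) of sl2-theory, for adjoint
   operators, where [h = [a, z]] and [[h, a] = 2 a]. *)
Lemma adpow_commutator a z h M y : h = bracket a z -> bracket h a = a *+ 2 ->
  adpow a M.+1 (bracket z y) = bracket z (adpow a M.+1 y)
    + (adpow a M (bracket h y) + adpow a M y *+ M) *+ M.+1.
Proof.
move=> hE ha.
have Az u : bracket a (bracket z u) = bracket z (bracket a u) + bracket h u.
  by rewrite hE bracket_jacobi addrC subrK.
have hA := bracket_weight2 _ ha.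
elim: M y => [|M IHM] y; first by rewrite /= Az mulr0n addr0.
have adS i u : adpow a i.+1 u = adpow a i (bracket a u) by rewrite /adpow iterSr.
have adMn i u c : adpow a i (u *+ c) = adpow a i u *+ c.
  by elim: i => //= i ->; rewrite bracketMnr.
rewrite adS Az (adpowD a M.+1 (bracket z (bracket a y)) (bracket h y)) IHM hA.
rewrite (adpowD a M (bracket a (bracket h y)) (bracket a y *+ 2)) adMn -!adS.
rewrite -addrA; congr (_ + _).
move: (adpow _ _ _) (adpow _ _ _) => X Y.
by apply/matrixP=> i j; rewrite -!scaler_nat !mxE; ring.
Qed.

End Bracket.

(** * The Killing form of a matrix Lie algebra *)

Section Killing.
Variables (k : closedFieldType) (char0 : [pchar k] =i pred0) (n : nat).
Implicit Types (a g x y z : 'M[k]_n).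
Variable V : {vspace 'M[k]_n}.
Hypothesis Vbr : forall x y, x \in V -> y \in V -> bracket x y \in V.

Let e := vbasis {: subvs_of V}.
Let bas_e : basis_of {: subvs_of V} e. Proof. exact: vbasisP. Qed.

Lemma vsval_ad x (y : subvs_of V) : (forall y, y \in V -> bracket x y \in V) ->
  vsval (ad V x y) = bracket x (vsval y).
Proof. by move=> xV; rewrite adE vsprojK // xV ?subvsP. Qed.

Lemma vsval_ad_pow x i (y : subvs_of V) : (forall y, y \in V -> bracket x y \in V) ->
  vsval (lfun_pow (ad V x) i y) = adpow x i (vsval y).
Proof.
move=> xV; elim: i => [|i IHi] /=; first by rewrite id_lfunE.
by rewrite comp_lfunE vsval_ad // IHi.
Qed.

(** Replaces the endomorphisms of [subvs_of V] that occur in heights by iterated brackets of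
    matrices. *)
Lemma ad_pow_neq0 x i : (forall y, y \in V -> bracket x y \in V) ->
  lfun_pow (ad V x) i != 0 <-> exists2 y, y \in V & adpow x i y != 0.
Proof.
move=> xV; split=> [nz|[y yV]]; last first.
  apply: contraNneq => f0; rewrite -(vsprojK yV) -vsval_ad_pow // f0.
  by rewrite zero_lfunE linear0.
apply: contrapT => none; move/negP: nz; apply; apply/eqP/lfunP => y.
rewrite zero_lfunE; apply: val_inj; rewrite [LHS]vsval_ad_pow // linear0.
apply/eqP/negPn/negP => nz; apply: none; exists (vsval y) => //; exact: subvsP.
Qed.

Lemma ad_bracket x y : x \in V -> y \in V ->
  ad V (bracket x y) = ((ad V x \o ad V y) - (ad V y \o ad V x))%VF.
Proof.
move=> xV yV; apply/lfunP => z; apply: val_inj.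
rewrite add_lfunE opp_lfunE !comp_lfunE.
rewrite [LHS]vsval_ad; last by move=> u; apply/Vbr/Vbr.
by rewrite linearB /= !vsval_ad ?bracket_jacobi // => u; apply: Vbr.
Qed.

Let mx (f : 'End(subvs_of V)) := mxof e e f.
(** Matrices act on row vectors, which reverses composition. *)
Let mx_comp f f' : mx (f \o f')%VF = mx f' * mx f.
Proof. exact: mxof_comp. Qed.
Let mxB f f' : mx (f - f') = mx f - mx f'.
Proof. exact: linearB. Qed.
Let killingE x y : killing V x y = \tr (mx (ad V y) * mx (ad V x)).
Proof. by rewrite /killing -/e -/(mx _) mx_comp. Qed.

Lemma killingC x y : killing V x y = killing V y x.
Proof. by rewrite !killingE -!mulmxE mxtrace_mulC. Qed.

Lemma killing_linearr c x y z : killing V z (c *: x + y) = c * killing V z x + killing V z y.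
Proof. by rewrite ![killing V z _]killingC killing_linearl. Qed.

Lemma killing0l z : killing V 0 z = 0.
Proof.
by have := killing_linearl V (-1) 0 0 z; rewrite scaler0 addr0 mulN1r addNr.
Qed.

Lemma killingNl x z : killing V (- x) z = - killing V x z.
Proof. by rewrite -scaleN1r -[_ *: _]addr0 killing_linearl killing0l addr0 mulN1r. Qed.

Lemma killing_bracket x y z : x \in V -> y \in V -> z \in V ->
  killing V (bracket x y) z = killing V x (bracket y z).
Proof.
move=> xV yV zV; rewrite !killingE !ad_bracket // !mxB !mx_comp.
rewrite mulrBr mulrBl !linearB /= !mulrA.
by congr (_ - _); rewrite -!mulmxE mxtrace_mulC !mulmxA.
Qed.

Lemma killing_conj g x y : g \in unitmx -> x \in V -> y \in V ->
  (forall x, x \in V -> g *m x *m invmx g \in V) ->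
  (forall x, x \in V -> invmx g *m x *m g \in V) ->
  killing V (g *m x *m invmx g) (g *m y *m invmx g) = killing V x y.
Proof.
move=> gU xV yV gV gV'.
have lin_c (p q : 'M[k]_n) : linear (fun u : subvs_of V => vsproj V (p *m vsval u *m q)).
  move=> c u v; rewrite [vsval _](linearP vsval) mulmxDr mulmxDl -scalemxAr -scalemxAl.
  by rewrite linearP.
pose c p q : {linear subvs_of V -> subvs_of V} := HB.pack
  (fun u : subvs_of V => vsproj V (p *m vsval u *m q)) (GRing.isLinear.Build _ _ _ _ _ (lin_c p q)).
pose C := linfun (c g (invmx g)); pose C' := linfun (c (invmx g) g).
have CE u : vsval (C u) = g *m vsval u *m invmx g.
  by rewrite lfunE /= vsprojK // gV ?subvsP.
have C'E u : vsval (C' u) = invmx g *m vsval u *m g.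
  by rewrite lfunE /= vsprojK // gV' ?subvsP.
have CK : (C' \o C)%VF = \1%VF.
  apply/lfunP=> u; apply: val_inj; rewrite comp_lfunE id_lfunE [LHS]C'E CE.
  by rewrite !mulmxA mulVmx // mul1mx mulmxKV.
have adJ z : z \in V -> ad V (g *m z *m invmx g) = (C \o (ad V z \o C'))%VF.
  move=> zV; apply/lfunP=> u; apply: val_inj; rewrite !comp_lfunE [RHS]CE.
  rewrite [vsval (ad V z _)]vsval_ad; last by move=> v; apply: Vbr.
  rewrite [LHS]vsval_ad ?C'E; last by move=> v; apply/Vbr/gV.
  rewrite -bracket_conj //; congr (bracket _ _).
  by rewrite !mulmxA mulmxV // mul1mx mulmxK.
have mxCK : mx C * mx C' = 1 by rewrite -mx_comp CK /mx mxof1 ?(basis_free bas_e).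
rewrite !killingE !adJ // !mx_comp.
set X := mx (ad V x); set Y := mx (ad V y).
have -> : mx C' * Y * mx C * (mx C' * X * mx C) = mx C' * (Y * X * mx C).
  by rewrite !mulrA -[_ * mx C * mx C']mulrA mxCK mulr1.
by rewrite -mulmxE mxtrace_mulC mulmxE -mulrA mxCK mulr1.
Qed.

Lemma mxof_pow f i : mx (lfun_pow f i) = mx f ^+ i.
Proof.
elim: i => [|i IHi] /=; first by rewrite expr0 /mx mxof1 ?(basis_free bas_e).
by rewrite mx_comp IHi exprSr.
Qed.

(** [ad a] is nilpotent and commutes with [[ad a, ad y] = ad [a, y]], so [mxtrace_mul_nilpotent]
    applies to the adjoint matrices. *)
Lemma killing_nilpotent a y : a \in V -> nilpotent_mx a -> y \in V ->
  bracket a (bracket a y) = 0 -> killing V a y = 0.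
Proof.
move=> aV [m am0] yV aay.
rewrite killingE -mulmxE mxtrace_mulC mulmxE; apply: (mxtrace_mul_nilpotent char0).
  exists (m + m)%N; rewrite -mxof_pow; suff -> : lfun_pow (ad V a) (m + m) = 0.
    by rewrite /mx linear0.
  apply/eqP/negPn/negP => /ad_pow_neq0[|u uV]; first by move=> u; apply: Vbr.
  by rewrite adpow_nilpotent // eqxx.
have ad0 : ad V 0 = 0 by rewrite -(subrr (0 : 'M[k]_n)) -scaleN1r addrC ad_linear scaleN1r addNr.
have := ad_bracket aV (Vbr aV yV); rewrite aay ad0 (ad_bracket aV yV).
move/(congr1 mx); rewrite mxB !mx_comp mxB !mx_comp [mx 0]linear0.
move/esym/eqP; rewrite subr_eq0 => /eqP E.
by rewrite -[_ * _ - _]opprB mulrN mulNr E.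
Qed.

End Killing.

(** * Weight vectors and traces *)

Section TraceLemmas.
Variables (k : closedFieldType) (char0 : [pchar k] =i pred0) (n : nat).
Implicit Types (a b c r x y z h : 'M[k]_n).

Lemma bracket_comm r a : bracket a r = 0 -> GRing.comm r a.
Proof. by move/eqP; rewrite subr_eq0 => /eqP. Qed.

Lemma mxtrace_exp_bracket r b c j : GRing.comm r c -> \tr (r ^+ j * bracket b c) = 0.
Proof.
move=> rc; have rjc : r ^+ j * c = c * r ^+ j by apply/commr_sym/commrX/commr_sym.
rewrite /bracket !mulmxE mulrBr linearB /= !mulrA rjc.
by rewrite -!mulmxE mxtrace_mulC mulmxA subrr.
Qed.

(** Up to a nonzero scalar [r ^+ i.+1] is [r ^+ i * [h, r]], which has trace 0 because [r] commutes
    with its powers. *)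
Lemma nilpotent_weight h r j : bracket h r = r *+ j.+1 -> nilpotent_mx r.
Proof.
move=> hr; apply: (nilpotent_trX char0) => i; apply/eqP.
have := mxtrace_exp_bracket h i (erefl (r * r)); rewrite hr mulrnAr -exprSr => /eqP.
rewrite -scaler_nat linearZ /= mulf_eq0 (negPf (natf_neq0_char0 char0 j)).
by [].
Qed.

Lemma bracket_adpow_weight a h M y : bracket h a = a *+ 2 ->
  bracket h (adpow a M y) = adpow a M (bracket h y) + adpow a M y *+ (M.*2).
Proof.
move=> ha; elim: M => [|M IHM]; first by rewrite addr0.
have hA := bracket_weight2 _ ha.
by rewrite /= hA IHM bracketDr bracketMnr -addrA -mulrnDr addn2.
Qed.

End TraceLemmas.

(** * The subalgebra [h] and the radical of the Killing form *)

Lemma lieS (k : closedFieldType) n (H G : set 'M[k]_n) : H `<=` G -> (lie H <= lie G)%VS.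
Proof.
by move=> HG; apply/subvP => x /lieP xH; apply/lieP => f fG; apply: xH => y /HG; apply: fG.
Qed.

Section Projection.
Variables (k : closedFieldType) (char0 : [pchar k] =i pred0) (n : nat) (G H : set 'M[k]_n).
Hypotheses (simpleG : simple_algebraic_group G) (Hsub : subgroup_GL H) (subHG : H `<=` G).
Let g := lie G.
Let h := lie H.
Let m := killing_perp g h.
Hypothesis direct_hm : directv (h + m).
Hypothesis detG : forall x, G x -> \det x = 1.
Implicit Types (a r u v w x y z : 'M[k]_n).

Let Gsub : subgroup_GL G. Proof. by case: simpleG => -[]. Qed.

Let GV x : G x -> G (invmx x). Proof. by case: Gsub => _ _ _; apply. Qed.
Let HV x : H x -> H (invmx x). Proof. by case: Hsub => _ _ _; apply. Qed.
Let GU x : G x -> x \in unitmx. Proof. by case: Gsub => + _ _ _; apply. Qed.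

Let hg x : x \in h -> x \in g. Proof. exact/subvP/lieS. Qed.

Let gJ : stable_under G g. Proof. by move=> s x Gs; apply: lie_stable. Qed.
Let hJ : stable_under H h. Proof. by move=> s x Hs; apply: lie_stable. Qed.

Let gbr x y : x \in g -> y \in g -> bracket x y \in g.
Proof. by move=> xg yg; apply: (bracket_stable char0 detG gJ). Qed.

Let hbr x y : x \in h -> y \in h -> bracket x y \in h.
Proof. by move=> xh yh; apply: (bracket_stable char0 (fun s Hs => detG (subHG Hs)) hJ). Qed.

Let Bil c x y z : killing g (c *: x + y) z = c * killing g x z + killing g y z.
Proof. exact: killing_linearl. Qed.
Let Bir c x y z : killing g z (c *: x + y) = c * killing g z x + killing g z y.
Proof. exact: killing_linearr. Qed.

Let killingJ s x y : G s -> x \in g -> y \in g ->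
  killing g (s *m x *m invmx s) (s *m y *m invmx s) = killing g x y.
Proof.
move=> Gs xg yg; apply: killing_conj => // [||z zg]; [exact: GU|by move=> z; apply: gJ|].
by have := gJ (GV Gs) zg; rewrite invmxK.
Qed.

Lemma killing_perp_stable (K : set 'M[k]_n) (U : {vspace 'M[k]_n}) : subgroup_GL K -> K `<=` G ->
  (U <= g)%VS -> stable_under K U -> stable_under K (killing_perp g U).
Proof.
move=> [_ _ _ KV] KG Ug UJ s x Ks /killing_perpP[xg xU]; apply/killing_perpP.
have Gs := KG _ Ks; split=> [|y yU]; first exact: gJ.
have y'U : invmx s *m y *m s \in U by have := UJ _ _ (KV _ Ks) yU; rewrite invmxK.
have -> : y = s *m (invmx s *m y *m s) *m invmx s.
  by rewrite !mulmxA mulmxV ?GU // mul1mx mulmxK ?GU.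
by rewrite killingJ ?xU //; apply: (subvP Ug).
Qed.

Lemma killing_perp_bracket (U : {vspace 'M[k]_n}) x y : (U <= g)%VS ->
  (forall u, u \in U -> bracket x u \in U) -> x \in g -> y \in killing_perp g U ->
  bracket x y \in killing_perp g U.
Proof.
move=> Ug xU xg /killing_perpP[yg yU]; apply/killing_perpP; split=> [|u uU]; first exact: gbr.
by rewrite bracketC killingNl killing_bracket ?yU ?xU ?oppr0 // (subvP Ug).
Qed.

Lemma killing_h_nondeg x : x \in h -> (forall y, y \in h -> killing g x y = 0) -> x = 0.
Proof.
move=> xh xperp; have xm : x \in m by apply/killing_perpP; split=> //; apply: hg.
move/directv_addP: direct_hm => hm0.
by apply/eqP; rewrite -memv0 -hm0 memv_cap xh.
Qed.

Let rad := killing_perp g g.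
Let rad_stable : stable_under G rad. Proof. exact: killing_perp_stable. Qed.
Let rad_bracket x r : x \in g -> r \in rad -> bracket x r \in rad.
Proof. by move=> xg; apply: killing_perp_bracket => // u; apply: gbr. Qed.
Let rad_g r : r \in rad -> r \in g. Proof. by case/killing_perpP. Qed.

Let linbr a : linear (bracket a). Proof. by move=> c x y; apply: bracket_linearr. Qed.
Definition bracket_linear a : {linear 'M[k]_n -> 'M[k]_n} :=
  HB.pack (bracket a) (GRing.isLinear.Build _ _ _ _ (bracket a) (linbr a)).

Section NilpotentInH.
Variable a : 'M[k]_n.
Hypotheses (ah : a \in h) (nz_a : a != 0) (nil_a : nilpotent_mx a).

(** Half of Jacobson-Morozov. If [y] in [h] is orthogonal to [[a, [a, h]]], invariance and
    nondegeneracy on [h] give [[a, [a, y]] = 0], so [y] is orthogonal to [a]. Taking double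
    orthogonals, [a] lies in [[a, [a, h]]]. *)
Lemma exists_sl2_pair : exists2 z, z \in h & bracket (bracket a z) a = a *+ 2.
Proof.
pose A := linfun (bracket_linear a).
have AE x : A x = bracket a x by rewrite lfunE.
pose U := (A @: (A @: h))%VS.
have Uh : (U <= h)%VS.
  by apply/subvP=> _ /memv_imgP[_ /memv_imgP[y yh ->] ->]; rewrite !AE; apply/hbr/hbr.
have [|u uU [_ au]] := mem_double_perp Bil Bir ah Uh.
  move=> y yh yU; have ya0 : bracket (bracket y a) a = 0.
    apply: killing_h_nondeg => [|w wh]; first by apply/hbr/ah/hbr/ah.
    rewrite !killing_bracket ?hg ?hbr //; apply: yU.
    by rewrite -!AE; apply/memv_img/memv_img.
  rewrite killingC; apply: killing_nilpotent => //; try exact: hg.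
  by rewrite (bracketC a y) bracketNr bracketC opprK.
have uh := subvP Uh _ uU.
have {au} au : a = u.
  apply/eqP; rewrite -subr_eq0; apply/eqP/killing_h_nondeg; first exact: memvB.
  by move=> y yh; rewrite killingC au.
case/memv_imgP: uU au => _ /memv_imgP[y yh ->] ->; rewrite !AE => aE.
(* From [a = [a, [a, y]]], the choice [z = - 2 y] gives [[[a, z], a] = 2 [a, [a, y]] = 2 a]. *)
exists (- (y *+ 2)); first by rewrite memvN rpredMn.
by rewrite bracketNr bracketMnr bracketC bracketNr opprK bracketMnr -aE.
Qed.

Lemma nilpotent_rad_eq0 r : r \in rad -> nilpotent_mx r -> r = 0.
Proof.
move=> rR [p rp]; apply/eqP/negPn/negP => nz_r.
have [z zh haa] := exists_sl2_pair.
have rp1 : r ^+ p.+1 = 0 by rewrite exprS rp mulr0.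
have := simple_bracket char0 simpleG (rad_g rR) nz_r rp1 rad_stable rR (hg ah) (hg (hbr ah zh)).
rewrite haa => a2R; have {a2R} /killing_perpP[_ aperp] : a \in rad.
  have -> : a = 2%:R^-1 *: (a *+ 2).
    by rewrite -scaler_nat scalerA mulVf ?scale1r // natf_neq0_char0.
  exact: memvZ.
by case/eqP: nz_a; apply: killing_h_nondeg => // y yh; rewrite aperp ?hg.
Qed.

(** Let [M > 0] be the last power of [ad a] that is nonzero on the radical, say at [u]. By
    [adpow_commutator], [(ad a)^M u] has weight [- M + 2 M = M] under [[a, z]]. A vector of positive
    weight is nilpotent, hence 0 in the radical. *)
Lemma bracket_rad_eq0 r : r \in rad -> bracket a r = 0.
Proof.
move=> rR; apply/eqP/negPn/negP => nz_ar.
have [z zh haa] := exists_sl2_pair.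
have [p ap] := nil_a.
pose P i := `[< exists2 r, r \in rad & adpow a i r != 0 >].
have exP : exists i, P i by exists 1%N; apply/asboolP; exists r.
have maxP i : P i -> (i <= p + p)%N.
  move=> /asboolP[u uR nz]; rewrite leqNgt; apply: contra nz => ip.
  rewrite -(subnK (ltnW ip)) /adpow iterD -!/(adpow _ _ _).
  by rewrite adpow_nilpotent // adpow0r.
case: (ex_maxnP exP maxP) => M /asboolP[u uR nz_u] maxM.
have M0 : (0 < M)%N by apply: (maxM 1%N); apply/asboolP; exists r.
have top v : v \in rad -> adpow a M.+1 v = 0.
  move=> vR; apply/eqP/negPn/negP => nz_v.
  by have /maxM : P M.+1 by [apply/asboolP; exists v]; rewrite ltnn.
have := adpow_commutator M u erefl haa; rewrite !top ?rad_bracket ?hg // bracket0r add0r.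
move/esym/(mulrn_mx_inj0 char0) => /eqP; rewrite addr_eq0 => /eqP hu.
have := bracket_adpow_weight M u haa; rewrite hu -addnn mulrnDr addKr => wt.
move/eqP: nz_u; apply; apply: nilpotent_rad_eq0.
  by apply: adpow_mem => // v; apply/rad_bracket/hg.
by apply: (@nilpotent_weight _ char0 _ (bracket a z) _ M.-1); rewrite prednK.
Qed.

(** The matrices [v] with [tr (r ^+ j * v) = 0] for all [r] in the radical form a [G]-stable space.
    It contains [a], since [2 a] is a bracket with [a] and [a] commutes with [r]; so it contains
    [[g, g]]. An [r] in the radical that is itself a bracket is then nilpotent. *)
Lemma bracket_cap_rad_eq0 y z : y \in g -> z \in g -> bracket z y \in rad -> bracket z y = 0.
Proof.
move=> yg zg rR; have [p ap] := nil_a; have [w wh haa] := exists_sl2_pair.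
pose P v := forall r j, r \in rad -> \tr (r ^+ j * v) = 0.
have PU v : v \in vspace_of P <-> P v.
  apply: vspace_ofP => [r j _|c u1 u2 Pu Pv r j rad_r]; first by rewrite mulr0 linear0.
  by rewrite -mulmxE mulmxDr -scalemxAr linearP /= !mulmxE Pu // Pv // mulr0 addr0.
have UJ : stable_under G (vspace_of P).
  move=> s v Gs /PU Pv; apply/PU => r j rR'.
  have r'R : invmx s *m r *m s \in rad by have := rad_stable (GV Gs) rR'; rewrite invmxK.
  have := conj_expr r j (etrans (unitmx_inv _) (GU Gs)); rewrite invmxK => rj.
  rewrite -[RHS](Pv _ j r'R) rj -!mulmxE -!mulmxA [RHS]mxtrace_mulC -!mulmxA.
  by rewrite (mxtrace_mulC (r ^+ j)) -!mulmxA.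
have aU : a \in vspace_of P.
  apply/PU => r j rR'.
  have -> : a = 2%:R^-1 *: bracket (bracket a w) a.
    by rewrite haa -scaler_nat scalerA mulVf ?scale1r // natf_neq0_char0.
  rewrite -mulmxE -scalemxAr linearZ /= mulmxE mxtrace_exp_bracket ?mulr0 //.
  exact/bracket_comm/bracket_rad_eq0.
have ap1 : a ^+ p.+1 = 0 by rewrite exprS ap mulr0.
have /PU tr0 := simple_bracket char0 simpleG (hg ah) nz_a ap1 UJ aU yg zg.
apply: nilpotent_rad_eq0 => //; apply: (nilpotent_trX char0) => j.
by rewrite exprSr tr0.
Qed.

Lemma nilpotent_mem_bracket e : e \in g -> nilpotent_mx e -> exists2 z, z \in g & e = bracket z e.
Proof.
move=> eg nil_e; pose A := linfun (bracket_linear e).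
have AE x : A x = bracket e x by rewrite lfunE.
pose U := (A @: g)%VS.
have Ug : (U <= g)%VS.
  by apply/subvP=> _ /memv_imgP[y yg ->]; rewrite AE; apply: gbr.
have [|u uU [rg rperp]] := mem_double_perp Bil Bir eg Ug.
  move=> y yg yU.
  have yeR : bracket y e \in rad.
    apply/killing_perpP; split=> [|w wg]; first exact: gbr.
    by rewrite killing_bracket // yU // -AE memv_img.
  rewrite killingC; apply: (killing_nilpotent char0) => //.
  by rewrite (bracketC e y) (bracket_cap_rad_eq0 eg yg yeR) oppr0 bracket0r.
case/memv_imgP: uU rg rperp => z zg ->; rewrite AE; set r := e - _ => rg rperp.
have rR : r \in rad by apply/killing_perpP; split=> // y yg; rewrite killingC rperp.
have rz v : v \in g -> GRing.comm r v.
  by move=> vg; apply: bracket_comm; apply: bracket_cap_rad_eq0 => //; apply: rad_bracket.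
have r0 : r = 0.
  apply: nilpotent_rad_eq0 => //; apply: (nilpotent_trX char0) => j.
  (* Expand the last factor as [r = e - [e, z]]: the bracket contributes trace 0 as [r] is central,
     and [r ^+ j * e] is nilpotent because [r] commutes with [e]. *)
  rewrite exprSr {2}/r mulrBr linearB /= mxtrace_exp_bracket ?subr0; last exact: rz.
  apply: nilpotent_mxtrace0; have [p ep] := nil_e; exists p.
  rewrite exprMn_comm ?ep ?mulr0 //; exact/commr_sym/commrX/commr_sym/rz.
exists (- z); first by rewrite memvN.
by rewrite bracketC bracketNr opprK; apply/eqP; rewrite -subr_eq0 -/r r0.
Qed.

End NilpotentInH.
End Projection.

(** * Scaling and leading coefficients in an orbit closure *)

Section OrbitClosure.
Variables (k : closedFieldType) (char0 : [pchar k] =i pred0) (n : nat) (G : set 'M[k]_n).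
Hypotheses (Gsub : subgroup_GL G) (detG : forall x, G x -> \det x = 1).
Variables (e z : 'M[k]_n).
Hypotheses (zG : z \in lie G) (ze : e = bracket z e).
Implicit Types (a x y : 'M[k]_n).

Let Orb := adj_sat G [set e].

Lemma orbitP x : Orb x <-> exists2 s, G s & x = s *m e *m invmx s.
Proof.
split=> [[s Gs [_ -> <-]]|[s Gs ->]]; first by exists s.
by exists s => //; exists e.
Qed.

Let GU s : G s -> s \in unitmx. Proof. by case: Gsub => + _ _ _; apply. Qed.

Lemma orbitJ s x : G s -> Orb x -> Orb (s *m x *m invmx s).
Proof.
move=> Gs /orbitP[t Gt ->]; apply/orbitP; exists (s *m t).
  by case: Gsub => _ _ + _; apply.
by rewrite invmxM_unit ?GU // !mulmxA.
Qed.

Lemma orbit_tangent f x y : vanishes_on f Orb -> Orb x -> y \in lie G ->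
  diffat f x (bracket y x) = 0.
Proof. by move=> fO Ox; apply: (diffat_adjoint char0 detG) => s Gs; apply/fO/orbitJ. Qed.

(** The Euler field is tangent to the orbit: conjugating [e = [z, e]] writes each point [x] of the
    orbit as a bracket of an element of [lie G] with [x]. The curve [C = (1 + t) y] satisfies
    [(1 + t) C' = C], the flow equation with [u = 1 + 'X]. *)
Lemma zclosure_orbitZ c x : zclosure Orb x -> zclosure Orb (c *: x).
Proof.
have orbZ y : Orb y -> zclosure Orb (c *: y).
  move=> Oy; pose C : 'M[{poly k}]_n := (1 + 'X) *: map_mx polyC y.
  have evC t : ev t C = (1 + t) *: y by rewrite evZ ev_const hornerD hornerC hornerX.
  have -> : c *: y = ev (c - 1) C by rewrite evC addrC subrK.
  apply: (@zclosure_flow k char0 n _ id (1 + 'X)) => //.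
  - exact: regular_mx_id.
  - by rewrite coefD coef1 coefX addr0.
  - move=> t; rewrite evC dmxZ_const derivD derivC derivX add0r scale1r ev_const.
    by rewrite hornerD hornerC hornerX.
  - by rewrite evC addr0 scale1r.
  move=> f fO x' Ox'; have /orbitP[s Gs x'E] := Ox'.
  rewrite {2}x'E ze -bracket_conj ?GU // -x'E; apply: orbit_tangent => //.
  exact: lie_stable.
move=> Ox f fO; apply: (zclosure_regular Ox (F := fun y => peval f (c *: y))).
  apply: (regular_comp (regular_peval f)) => i j.
  apply: (@regular_ext _ _ (fun y => c * y i j)); first by move=> y; rewrite mxE.
  by apply: regularM; [apply: regular_const|apply: regular_entry].
by move=> y Oy; apply: orbZ.
Qed.

(* The curve [t |-> exp (t ad a) y] lies in the orbit closure; rescaling it by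
   [t ^- M] and letting [t] go to infinity isolates its leading coefficient. *)
Lemma zclosure_orbit_adpow a y M : a \in lie G -> Orb y -> adpow a M.+1 y = 0 ->
  zclosure Orb (adpow a M y).
Proof.
move=> aG Oy top0.
pose c i : k := (i`!%:R)^-1.
pose C : 'M[{poly k}]_n := \sum_(i < M.+1) (c i *: 'X^i) *: map_mx polyC (adpow a i y).
have evC t : ev t C = \sum_(i < M.+1) (c i * t ^+ i) *: adpow a i y.
  by rewrite ev_sum; apply: eq_bigr => i _; rewrite evZ ev_const hornerZ hornerXn.
have flowC t : zclosure Orb (ev t C).
  apply: (@zclosure_flow k char0 n _ (bracket a) 1) => //.
  - exact: (regular_linear (bracket_linear a)).
  - by rewrite coef1.
  - move=> {}t; rewrite hornerC scale1r evC [bracket a _](linear_sum (bracket_linear a)) /=.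
    have -> : dmx C = \sum_(i < M) (c i *: 'X^i) *: map_mx polyC (adpow a i.+1 y).
      rewrite /C dmx_sum big_ord_recl dmxZ_const /= expr0 derivZ derivC scaler0 scale0r add0r.
      apply: eq_bigr => i _; rewrite dmxZ_const; congr (_ *: _).
      exact: deriv_divided_power.
    rewrite ev_sum big_ord_recr /= bracketZr (top0 : bracket a (adpow a M y) = 0) scaler0 addr0.
    by apply: eq_bigr => i _; rewrite evZ ev_const hornerZ hornerXn bracketZr.
  - rewrite evC big_ord_recl /= expr0 mulr1 /c fact0 invr1 scale1r big1 ?addr0 // => i _.
    by rewrite exprS mul0r mulr0 scale0r.
  by move=> f fO x Ox; apply: orbit_tangent.
suff lead : zclosure Orb (c M *: adpow a M y).
  have := zclosure_orbitZ (M`!%:R) lead; rewrite scalerA divff ?scale1r //.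
  by have := fact_gt0 M; case: (M`!)%N => // j _; apply: natf_neq0_char0.
(* [Z] is [t^M C(1/t)], so the limit at infinity becomes the value at [t = 0]. *)
pose Z : 'M[{poly k}]_n := \sum_(i < M.+1) (c i *: 'X^(M - i)) *: map_mx polyC (adpow a i y).
have evZZ t : ev t Z = \sum_(i < M.+1) (c i * t ^+ (M - i)) *: adpow a i y.
  by rewrite ev_sum; apply: eq_bigr => i _; rewrite evZ ev_const hornerZ hornerXn.
have Z0 : ev 0 Z = c M *: adpow a M y.
  rewrite evZZ big_ord_recr /= subnn expr0 mulr1 big1 ?add0r // => i _.
  have : (0 < M - i)%N by rewrite subn_gt0.
  by case: (M - i)%N => // j _; rewrite exprS mul0r mulr0 scale0r.
rewrite -Z0 => f fO; rewrite -along_ev.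
(* The factor ['X] takes care of [t = 0], where [C(1/t)] has no meaning. *)
suff : 'X * along f Z = 0.
  by move/eqP; rewrite mulf_eq0 polyX_eq0 /= => /eqP->; rewrite horner0.
apply: (poly_eq0_char0 char0) => t; rewrite hornerM hornerX along_ev.
have [->|nz_t] := eqVneq t 0; first by rewrite mul0r.
have -> : ev t Z = t ^+ M *: ev t^-1 C.
  rewrite evZZ evC scaler_sumr; apply: eq_bigr => i _; rewrite scalerA; congr (_ *: _).
  have iM : ((t == 0%R) + i <= M)%N by rewrite (negPf nz_t) add0n -ltnS; apply: ltn_ord.
  by rewrite (expfB_cond iM) exprVn mulrCA.
by rewrite (zclosure_orbitZ _ (flowC _)) ?mulr0.
Qed.

End OrbitClosure.

(** * Heights in terms of iterated brackets *)

Section Heights.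
Variables (k : closedFieldType) (n : nat) (V : {vspace 'M[k]_n}).
Hypothesis Vbr : forall x y, x \in V -> y \in V -> bracket x y \in V.
Implicit Types (x y s : 'M[k]_n).

Lemma is_heightP x j : x \in V -> is_height V x j <->
  (exists2 y, y \in V & adpow x j y != 0) /\
  forall i, (exists2 y, y \in V & adpow x i y != 0) -> (i <= j)%N.
Proof.
move=> xV; have adP i := ad_pow_neq0 i (fun y => @Vbr x y xV).
by split=> -[/adP nz le_j]; split=> // i /adP; apply: le_j.
Qed.

Lemma is_height_conj s x j : s \in unitmx ->
  (forall y, y \in V -> s *m y *m invmx s \in V) ->
  (forall y, y \in V -> invmx s *m y *m s \in V) ->
  x \in V -> is_height V x j -> is_height V (s *m x *m invmx s) j.
Proof.
move=> sU sV sV' xV /is_heightP[//|[y yV nz] le_j].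
have conj0 u : (s *m u *m invmx s == 0) = (u == 0).
  apply/eqP/eqP => [su0|->]; last by rewrite mulmx0 mul0mx.
  by rewrite -[u](mulKmx sU) -[s *m u](mulmxKV sU) su0 mul0mx mulmx0.
apply/is_heightP; first exact: sV.
split=> [|i [u uV nzu]].
  by exists (s *m y *m invmx s); [apply: sV|rewrite adpow_conj // conj0].
apply: le_j; exists (invmx s *m u *m s); first exact: sV'.
rewrite -conj0 -adpow_conj // !mulmxA mulmxV // mul1mx mulmxK //.
Qed.

End Heights.

(** * Equality of the two heights *)

Lemma regular_mx_exp (k : closedFieldType) n (T : 'M[k]_n -> 'M[k]_n) j :
  regular_mx T -> regular_mx (fun x => T x ^+ j).
Proof.
move=> rT; elim: j => [|j IHj]; first exact: regular_mx_const.
have eqT : (fun x => T x ^+ j.+1) = (fun x => T x *m T x ^+ j) by apply/funext => x; rewrite exprS.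
by rewrite eqT; apply: regular_mxM.
Qed.

Lemma daddv_pi_unique (K : fieldType) (vT : vectType K) (U V : {vspace vT}) u v :
  (U :&: V = 0)%VS -> u \in U -> v \in V -> daddv_pi U V (u + v) = u.
Proof.
move=> UV0 uU vV; rewrite linearD /= daddv_pi_id // .
have vUV : v \in (U + V)%VS by apply: (subvP (addvSr U V)).
have := daddv_pi_add UV0 vUV; rewrite [daddv_pi V U v]daddv_pi_id //; last by rewrite capvC.
by move/eqP; rewrite eq_sym -subr_eq subrr => /eqP <-; rewrite addr0.
Qed.

Theorem mainTheorem11 (k : closedFieldType) (char0 : [pchar k] =i pred0)
    (n : nat) (G H : set 'M[k]_n)
    (simpleG : simple_algebraic_group G)
    (semisimpleH : connected_semisimple_group H) (subHG : H `<=` G)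
    (g h m : {vspace 'M[k]_n})
    (defg : g = lie G) (defh : h = lie H) (defm : m = killing_perp g h)
    (sum_hm : (h + m)%VS = g) (direct_hm : directv (h + m))
    (Orb : set 'M[k]_n) (nilOrb : nonzero_nilpotent_orbit G Orb)
    (Orb_m : zclosure Orb `&` [set x | x \in m] = [set 0])
    (Omega : set 'M[k]_n) (denseOmega : dense_orbit H Orb Omega) :
  exists ht : nat,
    is_orbit_height h (daddv_pi h m @` Omega) ht /\
    is_orbit_height g (adj_sat G (daddv_pi h m @` Omega)) ht.
Proof.
case: semisimpleH => -[Hsub _] _ _.
have Gsub : subgroup_GL G by case: simpleG => -[].
have [GU G1 GM GV] := Gsub; have [_ _ HM HV] := Hsub.
case: nilOrb => e0 [e0G nz_e0 [p e0p] OrbE].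
have e0p1 : e0 ^+ p.+1 = 0 by rewrite exprS e0p mulr0.
have detG := simple_det1 char0 simpleG e0G nz_e0 e0p1.
have gJ : stable_under G g by move=> s x Gs; rewrite defg; apply: lie_stable.
have hJ : stable_under H h by move=> s x Hs; rewrite defh; apply: lie_stable.
have hgS : (h <= g)%VS by rewrite -sum_hm addvSl.
have gbr x y : x \in g -> y \in g -> bracket x y \in g.
  by move=> xg yg; apply: (bracket_stable char0 detG gJ); rewrite -?defg.
have hbr x y : x \in h -> y \in h -> bracket x y \in h.
  move=> xh yh; apply: (bracket_stable char0 (fun s Hs => detG s (subHG s Hs)) hJ) => //.
  by rewrite -defh.
have mJ : stable_under H m.
  rewrite defm defg; by apply: (killing_perp_stable char0 simpleG detG); rewrite -?defg.
have mbr x y : x \in h -> y \in m -> bracket x y \in m.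
  move=> xh; rewrite defm defg; apply: (killing_perp_bracket char0 simpleG detG); rewrite -?defg //.
  - by move=> u; apply: hbr.
  - exact: (subvP hgS).
have hm0 : (h :&: m = 0)%VS by apply/directv_addP.
pose phi := daddv_pi h m.
have phih x : phi x \in h by exact: memv_pi.
have split_hm x : x \in g -> exists2 v, v \in m & x = phi x + v.
  move=> xg; exists (daddv_pi m h x); first exact: memv_pi.
  by rewrite daddv_pi_add // sum_hm.
have phiJ s x : H s -> x \in g -> phi (s *m x *m invmx s) = s *m phi x *m invmx s.
  move=> Hs xg; have [v vm {1}->] := split_hm x xg.
  by rewrite mulmxDr mulmxDl /phi daddv_pi_unique //; [apply: hJ|apply: mJ].
case: denseOmega => -[e OmegaE] OmO Odense.
have Ome : Omega e.
  by rewrite OmegaE; exists 1%:M; [case: Hsub|exists e; rewrite ?mul1mx ?invmx1 ?mulmx1].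
have OmegaP x : Omega x -> exists2 s, H s & x = s *m e *m invmx s.
  by rewrite OmegaE => -[s Hs [_ -> <-]]; exists s.
have OrbP x : Orb x -> exists2 s, G s & x = s *m e0 *m invmx s.
  by rewrite OrbE => -[s Gs [_ -> <-]]; exists s.
have Orbg x : Orb x -> x \in g by case/OrbP=> s Gs ->; apply: gJ; rewrite ?defg.
have Orb0 x : zclosure Orb x -> x \in m -> x = 0.
  by move=> Ox xm; have : [set 0] x by rewrite -Orb_m.
have eg := Orbg _ (OmO _ Ome).
pose a := phi e; have ah : a \in h by apply: phih.
have ag := subvP hgS _ ah.
have nz_a : a != 0.
  apply: contraNneq nz_e0 => a0; have [v vm] := split_hm e eg.
  rewrite -/a a0 add0r => ev; have [s Gs eE] := OrbP _ (OmO _ Ome).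
  have e_0 : e = 0 by apply: Orb0; [apply/sub_zclosure/OmO|rewrite ev].
  rewrite -[e0](mulKmx (GU _ Gs)) -[s *m e0](mulmxKV (GU _ Gs)) -eE e_0.
  by rewrite mul0mx mulmx0.
have nil_a : nilpotent_mx a.
  apply: (nilpotent_trX char0) => j.
  have reg : regular (fun x => \tr (phi x ^+ j.+1) - \tr (a ^+ j.+1)).
    apply: regularB (regular_const _ _); apply: regular_mxtrace.
    exact/regular_mx_exp/regular_linear.
  have Om0 x : Omega x -> \tr (phi x ^+ j.+1) - \tr (a ^+ j.+1) = 0.
    case/OmegaP=> s Hs ->; have sU := GU _ (subHG _ Hs).
    by rewrite phiJ // conj_expr // -mulmxA mxtrace_mulC mulmxKV // subrr.
  (* By [Orb_m], 0 lies in the closure of [Orb], hence in that of its dense subset [Omega]. *)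
  have cl0 : zclosure Omega 0.
    apply: (zclosureS Odense); have : [set 0] (0 : 'M[k]_n) by [].
    by rewrite -Orb_m => -[].
  have := zclosure_regular cl0 reg Om0.
  by rewrite linear0 exprS mul0r linear0 sub0r => /eqP; rewrite oppr_eq0 => /eqP.
have direct' : directv (lie H + killing_perp (lie G) (lie H)).
  by rewrite -defh -defg -defm.
have ah' : a \in lie H by rewrite -defh.
have [z zh haa] := exists_sl2_pair char0 simpleG Hsub subHG direct' detG ah' nil_a.
rewrite -defh in zh; have zg := subvP hgS _ zh.
have [z0 z0G e0E] := nilpotent_mem_bracket char0 simpleG Hsub subHG direct' detG
  ah' nz_a nil_a e0G (ex_intro _ p e0p).
have ahh : bracket a (bracket a z) != 0.
  by rewrite bracketC haa oppr_eq0; apply: contraNneq nz_a => /(mulrn_mx_inj0 char0) ->.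
have [q aq] := nil_a.
pose P i := `[< exists2 y, y \in g & adpow a i y != 0 >].
have exP : exists i, P i by exists 0%N; apply/asboolP; exists a.
have maxP i : P i -> (i <= q + q)%N.
  move=> /asboolP[u ug nz]; rewrite leqNgt; apply: contra nz => iq.
  rewrite -(subnK (ltnW iq)) /adpow iterD -!/(adpow _ _ _).
  by rewrite adpow_nilpotent // adpow0r.
case: (ex_maxnP exP maxP) => N /asboolP[y yg nz_y] maxN.
(* [[a, z]] is not killed by [ad a]; positivity allows the division by [N] below. *)
have N0 : (0 < N)%N by apply: (maxN 1%N); apply/asboolP; exists (bracket a z) => //; apply: gbr.
have top v : v \in g -> adpow a N.+1 v = 0.
  move=> vg; apply/eqP/negPn/negP => nz_v.
  by have /maxN : P N.+1 by [apply/asboolP; exists v]; rewrite ltnn.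
(* An element of [[g, g]] that [(ad a)^N] does not kill. *)
have nz_hy : adpow a N (bracket (bracket a z) y) != 0.
  have := adpow_commutator N y erefl haa; rewrite !top ?gbr // bracket0r add0r.
  move/esym/(mulrn_mx_inj0 char0) => /eqP; rewrite addr_eq0 => /eqP ->.
  rewrite oppr_eq0 -(prednK N0); apply: contraNneq nz_y => /(mulrn_mx_inj0 char0).
  by rewrite prednK // => ->.
have [u uh nz_u] : exists2 u, u \in h & adpow a N u != 0.
  apply: contrapT => no_u.
  have hN0 u : u \in h -> adpow a N u = 0.
    by move=> uh; apply/eqP/negPn/negP => nz; apply: no_u; exists u.
  (* [Q] describes the largest [G]-stable subspace killed by [(ad a)^N]. Containing [e0], it would
     contain [[g, g]], against [nz_hy]. *)
  pose Q w := forall s, G s -> adpow a N (s *m w *m invmx s) = 0.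
  have QU w : w \in vspace_of Q <-> Q w.
    apply: vspace_ofP => [s _|c u1 u2 Q1 Q2 s Gs]; first by rewrite mulmx0 mul0mx adpow0r.
    rewrite mulmxDr mulmxDl -scalemxAr -scalemxAl adpow_linear Q1 // Q2 //.
    by rewrite scaler0 addr0.
  have QJ : stable_under G (vspace_of Q).
    move=> s w Gs /QU Qw; apply/QU => t Gt.
    have -> : t *m (s *m w *m invmx s) *m invmx t = (t *m s) *m w *m invmx (t *m s).
      by rewrite invmxM_unit ?GU // !mulmxA.
    by apply: Qw; apply: GM.
  have e0Q : e0 \in vspace_of Q.
    apply/QU => s Gs; set x := _ *m _.
    have Ox : Orb x by rewrite OrbE; exists s => //; exists e0.
    have xg := Orbg _ Ox; have [v vm xE] := split_hm x xg.
    (* Only the [m]-part of [x] contributes to [(ad a)^N x], which therefore lies in [m]. *)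
    apply: Orb0; last first.
      rewrite xE adpowD hN0 ?phih // add0r.
      by apply: adpow_mem => // w; apply: mbr.
    rewrite OrbE; apply: (zclosure_orbit_adpow char0 Gsub detG z0G e0E); rewrite -?defg //.
      by rewrite -OrbE.
    exact: top.
  have hhg : bracket a z \in g by apply: gbr.
  have /QU/(_ 1%:M G1) := simple_bracket char0 simpleG e0G nz_e0 e0p1 QJ e0Q
    (eq_ind _ (fun U : {vspace _} => y \in U) yg _ defg)
    (eq_ind _ (fun U : {vspace _} => bracket a z \in U) hhg _ defg).
  by rewrite invmx1 mul1mx mulmx1 => /eqP; apply/negP.
have htg : is_height g a N.
  by apply/(is_heightP gbr N ag); split=> [|i Pi]; [exists y|apply/maxN/asboolP].
have hth : is_height h a N.
  apply/(is_heightP hbr N ah); split=> [|i [v vh nz_v]]; first by exists u.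
  by apply/maxN/asboolP; exists v => //; apply: (subvP hgS).
have gJ' s x : G s -> x \in g -> invmx s *m x *m s \in g.
  by move=> Gs xg; have := gJ _ _ (GV _ Gs) xg; rewrite invmxK.
have hJ' s x : H s -> x \in h -> invmx s *m x *m s \in h.
  by move=> Hs xh; have := hJ _ _ (HV _ Hs) xh; rewrite invmxK.
(* By equivariance of [phi], the elements of the two sets are conjugates of [a] under [H] and under
   [G]. *)
exists N; split.
  move=> _ [x /OmegaP[s Hs ->] <-]; rewrite -/phi phiJ //.
  apply: (is_height_conj hbr) => //; first exact/GU/subHG.
    by move=> v; apply: hJ.
  by move=> v; apply: hJ'.
move=> _ [t Gt [_ [x /OmegaP[s Hs ->] <-] <-]]; rewrite -/phi phiJ //.
have Gs := subHG _ Hs.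
have -> : t *m (s *m phi e *m invmx s) *m invmx t = (t *m s) *m a *m invmx (t *m s).
  by rewrite invmxM_unit ?GU // !mulmxA.
have Gts := GM _ _ Gt Gs.
apply: (is_height_conj gbr) => //; first exact: GU.
  by move=> v; apply: gJ.
by move=> v; apply: gJ'.
Qed.
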